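(* Let $\Gamma$ be a singular branch of plane curve. Then $n,\overline\beta_1,\dots,\overline\beta_g$ all belong to the $\mathcal S$-basis of values of $\Gamma$, i.e. the minimal generating set of $\Lambda_\Gamma$ as a semimodule over $\mathcal S_\Gamma$ contains the minimal generating set $\{n,\overline\beta_1,\dots,\overline\beta_g\}$ of the semigroup $\mathcal S_\Gamma$.
   Context: Let $\Gamma$ be a singular irreducible germ of holomorphic curve at $0\in\mathbb C^2$ with Puiseux parametrization $\Gamma(t)=(t^n,\sum_{\beta\ge\beta_1}a_{\beta,\Gamma}t^\beta)$, $n\ge2$ its multiplicity, $\beta_1<\dots<\beta_g$ its Puiseux characteristic exponents. Put $e_0=n$, $e_j=\gcd(e_{j-1},\beta_j)$, $n_j=e_{j-1}/e_j$; $\overline\beta_1=\beta_1$, $\overline\beta_j=n_{j-1}\overline\beta_{j-1}-\beta_{j-1}+\beta_j$ ($2\le j\le g$). For $f\in\mathbb C[[x,y]]$, $\nu_\Gamma(f)=\mathrm{ord}_tf(\Gamma(t))$; for a 1-form $\omega$ with $\Gamma^*\omega=h(t)dt$, $\nu_\Gamma(\omega)=\mathrm{ord}_th+1$. $\mathcal S_\Gamma=\{\nu_\Gamma(f):f\in\mathbb C\{x,y\},f(0)=0\}$, minimally generated by $n,\overline\beta_1,\dots,\overline\beta_g$; $\Lambda_\Gamma=\{\nu_\Gamma(\omega):\omega$ germ of holomorphic 1-form$\}\setminus\{\infty\}$. An $\mathcal S$-collection is $S\subset\mathbb Z_{>0}$ with $S+\mathcal S_\Gamma\subset S$; the $\mathcal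 S$-basis of values of $\Gamma$ is the minimal subset $T$ of $\Lambda_\Gamma$ with $T+(\mathcal S_\Gamma\cup\{0\})=\Lambda_\Gamma$. *)

(* Defs.v *)
From mathcomp Require Import all_boot all_algebra.
From mathcomp Require Import reals.
From mathcomp.real_closed Require Import complex.
Set Implicit Arguments. Unset Strict Implicit. Unset Printing Implicit Defensive.
Import GRing.Theory Num.Theory.
Local Open Scope ring_scope.

Section PowerSeries.
Variable C : numClosedFieldType.

(* One-variable (formal) power series in t: coefficient sequences  nat -> C.
   Two-variable power series in x,y: coefficient families  nat -> nat -> C
   (f i j is the coefficient of x^i y^j). *)

Definition conv1 (a : nat -> C) : Prop :=
  exists r M : C, 0 < r /\ forall k, `|a k| * r ^+ k <= M.
Definition conv2 (f : nat -> nat -> C) : Prop :=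
  exists r M : C, 0 < r /\ forall i j, `|f i j| * r ^+ (i + j) <= M.

Definition smul (a b : nat -> C) : nat -> C :=
  fun k => \sum_(l < k.+1) a l * b (k - l)%N.
Definition sone : nat -> C := fun k => (k == 0%N)%:R.
Definition spow (a : nat -> C) (j : nat) : nat -> C := iter j (smul a) sone.
Definition sderiv (a : nat -> C) : nat -> C := fun k => a k.+1 * (k.+1)%:R.

Definition tpow (n : nat) : nat -> C := fun k => (k == n)%:R.

(* f(x(t), y(t)) for series x, y without constant term
   (only x^i y^j with i, j <= k contribute to the coefficient of t^k). *)
Definition scomp (f : nat -> nat -> C) (x y : nat -> C) : nat -> C :=
  fun k => \sum_(i < k.+1) \sum_(j < k.+1) f i j * smul (spow x i) (spow y j) k.

Definition ord_is (h : nat -> C) (k : nat) : Prop :=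
  (forall l, (l < k)%N -> h l = 0) /\ h k != 0.

(* Gamma(t) = (t^n, phi(t)).  nu_Gamma(f) = ord_t f(Gamma(t)). *)
Definition nu_is (n : nat) (phi : nat -> C) (f : nat -> nat -> C) (k : nat) :=
  ord_is (scomp f (tpow n) phi) k.

Definition semigroup (n : nat) (phi : nat -> C) : nat -> Prop :=
  fun k => exists f, conv2 f /\ f 0%N 0%N = 0 /\ nu_is n phi f k.

(* For omega = A dx + B dy :  Gamma^* omega = h(t) dt with
   h = A(Gamma(t)) x'(t) + B(Gamma(t)) y'(t);  nu_Gamma(omega) = ord_t h + 1. *)
Definition pullback (n : nat) (phi : nat -> C) (A B : nat -> nat -> C) : nat -> C :=
  fun k => smul (scomp A (tpow n) phi) (sderiv (tpow n)) k
         + smul (scomp B (tpow n) phi) (sderiv phi) k.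

Definition values_forms (n : nat) (phi : nat -> C) : nat -> Prop :=
  fun m => exists A B, conv2 A /\ conv2 B /\
    exists k, ord_is (pullback n phi A B) k /\ m = k.+1.

End PowerSeries.

Definition generates (S L T : nat -> Prop) : Prop :=
  forall m, L m <-> exists t s, T t /\ (s = 0%N \/ S s) /\ m = (t + s)%N.

Definition is_S_basis (S L T : nat -> Prop) : Prop :=
  (forall t, T t -> L t) /\ generates S L T /\
  forall T' : nat -> Prop, (forall t, T' t -> T t) -> generates S L T' ->
    forall t, T t -> T' t.

(* Puiseux characteristic data.  b j = beta_j for 1 <= j <= g (b 0 unused).
   e_0 = n, e_j = gcd(e_{j-1}, beta_j). *)
Fixpoint char_e (n : nat) (b : nat -> nat) (j : nat) : nat :=
  match j with 0 => n | j'.+1 => gcdn (char_e n b j') (b j) end.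

Definition char_exps {C : numClosedFieldType} (n : nat) (a : nat -> C)
    (g : nat) (b : nat -> nat) : Prop :=
  (forall j, (1 <= j <= g)%N ->
     [/\ a (b j) != 0, ~~ (char_e n b j.-1 %| b j)%N &
         forall k, (k < b j)%N -> a k != 0 -> (char_e n b j.-1 %| k)%N])
  /\ char_e n b g = 1%N.

Fixpoint betabar (n : nat) (b : nat -> nat) (j : nat) : nat :=
  match j with
  | 0 => 0
  | j'.+1 =>
      match j' with
      | 0 => b 1%N
      | _ => ((char_e n b j'.-1 %/ char_e n b j') * betabar n b j' + b j - b j')%N
      end
  end.

(* Main.v *)
(* The differentials of x and of semiroots f_j (products of conjugates of truncations
   of the branch) have values n and betabar_j, and n is the least value of a form, so
   it suffices that betabar_j is not nu(w) + nu(f) with f(0) = 0.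

   Let y = psi_j(t) + u t^beta_j be the curves sharing with the branch the terms of
   exponent less than beta_j. Induction on j, expanding along powers of the semiroots,
   shows that if w = A dx + B dy has degree less than n_1 .. n_(j-1) in y, its pullback
   by (t, u) -> (t^n, psi_j + u t^beta_j) starts either with p t^k dt/t, e_(j-1) | k,
   or with q t^k (s u dt/t + du), s > 0; functions f of such degree start with a
   constant times t^k, e_(j-1) | k.

   If nu(w) + nu(f) = betabar_j, dividing by f_j makes w and f of such degree. As
   e_(j-1) divides nu(f) but not betabar_j, w is of the second kind, and w /\ df shows
   that A f_y - B f_x has order betabar_j - beta_j - n on the branch, which is
   sum_(i<j) (n_i - 1) betabar_i - n, hence is not in the semigroup. *)
Require Import Defs.
From HB Require Import structures.
From mathcomp Require Import all_boot all_order all_algebra all_solvable all_field.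
From mathcomp Require Import reals.
From mathcomp.real_closed Require Import complex.
From mathcomp Require Import ring zify.
Import Order.TTheory GRing.Theory Num.Theory Pdiv.RingMonic.
Set Implicit Arguments. Unset Strict Implicit. Unset Printing Implicit Defensive.
Local Open Scope ring_scope.

(** * Leading terms in [t], weights modulo [e], and pullbacks of forms to a chart *)

Section Leading.
Variable C : numClosedFieldType.
Implicit Types (Z W : {poly {poly C}}) (P Q p : {poly C}) (k l m : nat).

(* [{poly {poly C}}] stands for C[x][y], and for C[t][u] in the charts: the outer
   variable is [y], respectively [u]. *)
Definition at_t0 Z : {poly C} := map_poly (horner_eval 0) Z.
HB.instance Definition _ := GRing.RMorphism.copy at_t0 (map_poly (horner_eval (0 : C))).

(* [Z = t^k (P(u) + O(t))]; as [P] may vanish, this only bounds the order below. *)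
Definition lead k Z P := exists2 Z', Z = ('X^k)%:P * Z' & at_t0 Z' = P.

(* The derivation t d/dt. *)
Definition theta Z : {poly {poly C}} := map_poly (fun p : {poly C} => 'X * p^`()) Z.

Lemma lead0 k : lead k 0 0.
Proof. by exists 0; rewrite ?mulr0 ?rmorph0. Qed.

Lemma leadD k Z W P Q : lead k Z P -> lead k W Q -> lead k (Z + W) (P + Q).
Proof.
by move=> [Z' -> <-] [W' -> <-]; exists (Z' + W'); rewrite ?mulrDr ?rmorphD.
Qed.

Lemma leadN k Z P : lead k Z P -> lead k (- Z) (- P).
Proof. by move=> [Z' -> <-]; exists (- Z'); rewrite ?mulrN ?rmorphN. Qed.

Lemma leadM k l Z W P Q : lead k Z P -> lead l W Q -> lead (k + l) (Z * W) (P * Q).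
Proof.
move=> [Z' -> <-] [W' -> <-]; exists (Z' * W'); rewrite ?rmorphM //=.
by rewrite exprD polyCM; ring.
Qed.

Lemma leadX k Z P m : lead k Z P -> lead (m * k) (Z ^+ m) (P ^+ m).
Proof.
move=> [Z' -> <-]; exists (Z' ^+ m); rewrite ?rmorphXn //=.
by rewrite mulnC exprM exprMn.
Qed.

Lemma lead_prod (I : Type) (r : seq I) (S : pred I) (k : I -> nat)
    (Z : I -> {poly {poly C}}) (c : I -> C) :
  (forall i, S i -> lead (k i) (Z i) (c i)%:P) ->
  lead (\sum_(i <- r | S i) k i) (\prod_(i <- r | S i) Z i)
       (\prod_(i <- r | S i) c i)%:P.
Proof.
move=> H; rewrite rmorph_prod /=.
elim/big_ind3: _ => // [|k1 Z1 P1 k2 Z2 P2]; last exact: leadM.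
by exists 1; rewrite ?mulr1 ?rmorph1.
Qed.

Lemma lead_sum (I : finType) (k : nat) (S : pred I)
    (Z : I -> {poly {poly C}}) (P : I -> {poly C}) :
  (forall i, S i -> lead k (Z i) (P i)) ->
  lead k (\sum_(i | S i) Z i) (\sum_(i | S i) P i).
Proof.
move=> H; elim/big_ind2: _ => // [|Z1 P1 Z2 P2]; [exact: lead0 | exact: leadD].
Qed.

Lemma lead_up k m Z P : lead k Z P -> (m < k)%N -> lead m Z 0.
Proof.
move=> [Z' -> _] lt_mk; exists (('X^(k - m))%:P * Z').
  by rewrite mulrA -polyCM -exprD subnKC // ltnW.
rewrite rmorphM /= /at_t0 map_polyC /= horner_evalE hornerXn expr0n.
by rewrite subn_eq0 leqNgt lt_mk mul0r.
Qed.

Lemma at_t0_theta Z : at_t0 (theta Z) = 0.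
Proof.
apply/polyP => m; rewrite coef0 coef_map coef_map_id0 /= ?deriv0 ?mulr0 //.
by rewrite horner_evalE hornerM hornerX mul0r.
Qed.

Lemma coef_theta Z m : (theta Z)`_m = 'X * (Z`_m)^`().
Proof. by rewrite coef_map_id0 // deriv0 mulr0. Qed.

Lemma thetaD Z W : theta (Z + W) = theta Z + theta W.
Proof. by apply/polyP=> m; rewrite coefD !coef_theta coefD derivD mulrDr. Qed.

Lemma thetaC p : theta p%:P = ('X * p^`())%:P.
Proof.
apply/polyP=> m; rewrite coef_theta !coefC; case: eqP => // _.
by rewrite deriv0 mulr0.
Qed.

Lemma thetaM Z W : theta (Z * W) = theta Z * W + Z * theta W.
Proof.
apply/polyP=> m; rewrite coefD coef_theta !coefM linear_sum mulr_sumr -big_split /=.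
apply: eq_bigr => i _; rewrite !coef_theta derivM; ring.
Qed.

Lemma theta0 : theta 0 = 0.
Proof. by rewrite -[0]/(0%:P) thetaC deriv0 mulr0. Qed.

Lemma thetaX : theta 'X = 0.
Proof.
apply/polyP=> m; rewrite coef_theta coefX coef0.
by case: (m == 1%N); rewrite /= ?derivC ?deriv0 ?mulr0 // -polyC1 derivC mulr0.
Qed.

Lemma theta_comp Z W :
  theta (Z \Po W) = (theta Z \Po W) + (Z^`() \Po W) * theta W.
Proof.
elim/poly_ind: Z => [|Z p IH].
  by rewrite !(deriv0, comp_poly0, theta0) mul0r addr0.
rewrite derivD derivM derivX derivC addr0 !(thetaD, thetaM, thetaX, thetaC) mulr0 addr0.
rewrite !(comp_polyD, comp_polyM, comp_polyX, comp_polyC) thetaD thetaM IH thetaC.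
by rewrite mulr1; ring.
Qed.

Lemma theta_Xn k : theta ('X^k)%:P = ('X^k)%:P *+ k.
Proof.
rewrite thetaC derivXn -polyCMn; congr (_ %:P).
by case: k => [|k]; rewrite ?mulr0n ?mulr0 //= mulrnAr -exprS.
Qed.

Lemma lead_theta k Z P : lead k Z P -> lead k (theta Z) (P *+ k).
Proof.
move=> [Z' -> <-]; exists (Z' *+ k + theta Z').
  by rewrite thetaM theta_Xn mulrDr mulrnAr mulrnAl.
by rewrite rmorphD rmorphMn /= at_t0_theta addr0.
Qed.

Lemma lead_deriv k Z P : lead k Z P -> lead k Z^`() P^`().
Proof.
move=> [Z' -> <-]; exists Z'^`(); first by rewrite derivM derivC mul0r add0r.
by rewrite /at_t0 deriv_map.
Qed.

Lemma lead_comp k Z P W c :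
  lead k Z P -> at_t0 W = c%:P -> lead k (Z \Po W) (P.[c])%:P.
Proof.
move=> [Z' -> <-] HW; exists (Z' \Po W).
  by rewrite comp_polyM comp_polyC.
by rewrite /at_t0 map_comp_poly -/(at_t0 W) HW comp_polyCr.
Qed.

Lemma leadP k Z P : lead k Z P <->
  forall m, P`_m = Z`_m`_k /\ forall l, (l < k)%N -> Z`_m`_l = 0.
Proof.
split=> [[Z' -> <-] m|H].
  rewrite coefCM coef_map /= horner_evalE horner_coef0; split=> [|l].
    by rewrite coefXnM ltnn subnn.
  by rewrite coefXnM => ->.
exists (map_poly (drop_poly k) Z).
  apply/polyP=> m; rewrite coefCM coef_map_id0 ?drop_poly0r //.
  apply/polyP=> l; rewrite coefXnM; case: ltnP => [|le_kl].
    by move/(proj2 (H m)).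
  by rewrite coef_drop_poly subnK.
apply/polyP=> m; rewrite coef_map /= horner_evalE coef_map_id0 ?drop_poly0r //.
by rewrite horner_coef0 coef_drop_poly (proj1 (H m)).
Qed.

Lemma coef_lead k Z P m : lead k Z P -> P`_m = Z`_m`_k.
Proof. by case/leadP/(_ m). Qed.

Lemma lead_uniq k Z P l Q : lead k Z P -> lead l Z Q -> P != 0 -> Q != 0 ->
  k = l /\ P = Q.
Proof.
have aux k' l' P' Q' : lead k' Z P' -> lead l' Z Q' -> P' != 0 -> (l' <= k')%N.
  move=> HP HQ; rewrite leqNgt; apply: contra_neqN => lt.
  apply/polyP=> m; rewrite (coef_lead m HP) coef0.
  by have [_ ->] := (proj1 (leadP _ _ _) HQ) m.
move=> HP HQ P0 Q0; have E : k = l.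
  by apply/eqP; rewrite eqn_leq (aux _ _ _ _ HP HQ) // (aux _ _ _ _ HQ HP).
split=> //; apply/polyP=> m.
by rewrite (coef_lead m HP) E (coef_lead m HQ).
Qed.

Lemma lead_cancelXn k m Z P :
  lead k (('X^m)%:P * Z) P -> P != 0 -> exists2 l, k = (m + l)%N & lead l Z P.
Proof.
move=> H P0.
have le_mk : (m <= k)%N.
  rewrite leqNgt; apply: contra_neqN P0 => lt.
  by apply/polyP=> i; rewrite (coef_lead i H) coefCM coefXnM lt coef0.
exists (k - m)%N; first by rewrite subnKC.
move/leadP: H => H; apply/leadP => i; have [-> H2] := H i.
rewrite coefCM coefXnM ltnNge le_mk /=; split=> // l lt.
have := H2 (m + l)%N; rewrite coefCM coefXnM [(_ < m)%N]ltnNge leq_addr /= addKn.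
by apply; rewrite -ltn_subRL.
Qed.

Lemma sum_neq0 (V : nmodType) (I : finType) (F : I -> V) :
  \sum_i F i != 0 -> exists i, F i != 0.
Proof.
move=> H; apply/existsP; rewrite -[[exists _, _]]negbK negb_exists.
by apply: contra H => /forallP H; rewrite big1 // => i _; apply/eqP; have := H i; rewrite negbK.
Qed.

(* [Z] is homogeneous modulo [e] when [t] has weight 1 and [u] has weight [- b]. *)
Definition cong (e b r : nat) Z :=
  forall m k, Z`_m`_k != 0 -> k = m * b + r %[mod e].

Lemma congD e b r Z W : cong e b r Z -> cong e b r W -> cong e b r (Z + W).
Proof.
move=> HZ HW m k; rewrite !coefD; have [Z0|/HZ] := eqVneq (Z`_m`_k) 0; last by [].
by rewrite Z0 add0r; apply: HW.
Qed.

Lemma congM e b r s Z W :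
  cong e b r Z -> cong e b s W -> cong e b (r + s) (Z * W).
Proof.
move=> HZ HW m k; rewrite coefM coef_sum => H; have [i {H}] := sum_neq0 H.
rewrite coefM => H; have [j {H}] := sum_neq0 H; rewrite mulf_eq0 negb_or => /andP[/HZ h1 /HW h2].
have -> : k = (j + (k - j))%N by rewrite subnKC // -ltnS.
rewrite -modnDm h1 h2 modnDm; congr (_ %% _)%N.
have := ltn_ord i; rewrite ltnS => le_im.
by rewrite -[in RHS](subnKC le_im) mulnDl; lia.
Qed.

Lemma congC e b r p : (forall k, p`_k != 0 -> k = r %[mod e]) -> cong e b r p%:P.
Proof.
move=> H m k; rewrite coefC; case: (m =P 0%N) => [->|_]; first exact: H.
by rewrite coef0 eqxx.
Qed.

Lemma congC0 e b p : (forall k, p`_k != 0 -> (e %| k)%N) -> cong e b 0 p%:P.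
Proof. by move=> H; apply: congC => k /H /eqP ->; rewrite mod0n. Qed.

Lemma cong_theta e b r Z : cong e b r Z -> cong e b r (theta Z).
Proof.
move=> H m k; rewrite coef_theta coefXM; case: (k =P 0%N) => [_|k0]; first by rewrite eqxx.
by rewrite coef_deriv; case: k k0 => // k _; have [->|/H] := eqVneq (Z`_m`_k.+1) 0; rewrite ?mul0rn ?eqxx.
Qed.

Lemma cong_lead e b r k Z P m :
  cong e b r Z -> lead k Z P -> P`_m != 0 -> k = m * b + r %[mod e].
Proof. by move=> H /coef_lead->; apply: H. Qed.

Lemma cong_XnX e m : cong e m 0 (('X^m)%:P * 'X : {poly {poly C}}).
Proof.
move=> l i; rewrite coefCM coefXnM coefX; case: ltnP => [|le_mi]; rewrite ?eqxx //.
case: (l =P 1%N) => [->|_]; rewrite ?coef0 ?eqxx // coef1 mul1n addn0.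
by case: (i - m =P 0)%N => [Ei _|_]; rewrite ?eqxx // -(subnK le_mi) Ei.
Qed.

Variable n : nat.
Hypothesis n_gt0 : (0 < n)%N.

Implicit Types (Y F A B : {poly {poly C}}).

(* [F(x, y)] at [x = t^n], [y = Y(t, u)]. *)
Lemma comp_Xn_inj : injective (comp_poly ('X^n : {poly C})).
Proof.
move=> p q Hpq; apply/polyP=> m.
have := congr1 (fun r : {poly C} => r`_(m * n)) Hpq.
by rewrite !coef_comp_poly_Xn // dvdn_mull // mulnK.
Qed.

Definition ev Y F : {poly {poly C}} := map_poly (comp_poly 'X^n) F \Po Y.
HB.instance Definition _ Y :=
  GRing.RMorphism.copy (ev Y) (comp_poly Y \o map_poly (comp_poly ('X^n : {poly C}))).

Definition dx F : {poly {poly C}} := map_poly (@deriv C) F.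

(* The pullback of [A dx + B dy] by [x = t^n], [y = Y(t, u)] is
   [formH dt/t + formQ du]. *)
Definition formH Y A B := ev Y A * ('X^n *+ n)%:P + ev Y B * theta Y.
Definition formQ Y B := ev Y B * Y^`().

Lemma ev_comp Y W F : ev (Y \Po W) F = ev Y F \Po W.
Proof. by rewrite /ev comp_polyA. Qed.

Lemma deriv_ev Y F : (ev Y F)^`() = ev Y F^`() * Y^`().
Proof. by rewrite /ev deriv_comp deriv_map. Qed.

Lemma theta_ev Y F :
  theta (ev Y F) = ev Y (dx F) * ('X^n *+ n)%:P + ev Y F^`() * theta Y.
Proof.
rewrite {1}/ev theta_comp deriv_map; congr (_ + _).
rewrite -[X in _ = _ * X](comp_polyC _ Y) /ev -comp_polyM; congr (_ \Po _).
apply/polyP=> m; rewrite coef_theta coefMC !coef_map /= deriv_comp derivXn.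
by rewrite mulrCA [in LHS]mulrnAr -exprS prednK.
Qed.

Lemma formH_comp Y W A B :
  formH (Y \Po W) A B = (formH Y A B \Po W) + (formQ Y B \Po W) * theta W.
Proof.
rewrite /formH /formQ !ev_comp theta_comp !(comp_polyD, comp_polyM, comp_polyC).
by rewrite mulrDr !mulrA addrA.
Qed.

Lemma formQ_comp Y W B : formQ (Y \Po W) B = (formQ Y B \Po W) * W^`().
Proof. by rewrite /formQ ev_comp deriv_comp comp_polyM mulrA. Qed.

Lemma formH_M Y F A B : formH Y (F * A) (F * B) = ev Y F * formH Y A B.
Proof. by rewrite /formH !rmorphM /=; ring. Qed.

Lemma formQ_M Y F B : formQ Y (F * B) = ev Y F * formQ Y B.
Proof. by rewrite /formQ rmorphM /= mulrA. Qed.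

Lemma formHD Y A B A' B' : formH Y (A + A') (B + B') = formH Y A B + formH Y A' B'.
Proof. by rewrite /formH !rmorphD /=; ring. Qed.

Lemma formH_sum Y (I : finType) (A B : I -> {poly {poly C}}) :
  formH Y (\sum_i A i) (\sum_i B i) = \sum_i formH Y (A i) (B i).
Proof. by rewrite /formH !rmorph_sum !mulr_suml -big_split. Qed.

Lemma formQ_sum Y (I : finType) (B : I -> {poly {poly C}}) :
  formQ Y (\sum_i B i) = \sum_i formQ Y (B i).
Proof. by rewrite /formQ rmorph_sum mulr_suml. Qed.

(* The pullbacks of [w /\ dF], for [w = A dx + B dy], computed in two ways. *)
Lemma formH_wedge Y A B F :
  formH Y A B * (ev Y F)^`() - formQ Y B * theta (ev Y F) =
  ev Y (A * F^`() - B * dx F) * ('X^n *+ n)%:P * Y^`().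
Proof.
by rewrite theta_ev deriv_ev /formH /formQ rmorphB !rmorphM /=; ring.
Qed.

(** Both [x = t^n] and [Y] have weight 0 modulo [e], the former because [e] divides [n]. *)
Lemma cong_ev e b Y F : (e %| n)%N -> cong e b 0 Y -> cong e b 0 (ev Y F).
Proof.
move=> en HY; elim/poly_ind: F => [|F p IH].
  by rewrite rmorph0 => m k; rewrite !coef0 eqxx.
rewrite rmorphD rmorphM /= {2 3}/ev map_polyX map_polyC /= comp_polyX comp_polyC.
apply: congD; first by rewrite -[0%N]addn0; apply: congM.
apply: congC0 => k; rewrite coef_comp_poly_Xn //.
by case: (boolP (n %| k)%N) => [/(dvdn_trans en)|]; rewrite ?eqxx.
Qed.

Lemma cong_formH e b Y A B :
  (e %| n)%N -> cong e b 0 Y -> cong e b 0 (formH Y A B).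
Proof.
move=> en HY; apply: congD.
  rewrite -[0%N]addn0; apply: congM; first exact: cong_ev.
  apply: congC0 => k; rewrite coefMn coefXn.
  by case: (k =P n) => [-> //|]; rewrite mul0rn eqxx.
by rewrite -[0%N]addn0; apply: congM; [exact: cong_ev | exact: cong_theta].
Qed.

End Leading.

(** * Expansion along powers of a monic polynomial *)

Section Expansion.
Variables (R : comNzRingType) (f : {poly R}) (N : nat).
Hypotheses (f_monic : f \is monic) (size_f : size f = N.+1).

Lemma monic_divide (A : {poly R}) :
  exists Q S : {poly R}, [/\ A = f * Q + S, (size S <= N)%N & (size Q <= size A - N)%N].
Proof.
have [q [r [E sr]]] : exists q r : {poly R}, A = f * q + r /\ (size r <= N)%N.
  exists (Pdiv.Ring.rdivp A f), (Pdiv.Ring.rmodp A f).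
  by rewrite mulrC -rdivp_eq // -ltnS -size_f Pdiv.Ring.ltn_rmodp monic_neq0.
exists q, r; split=> //; have [->|q0] := eqVneq q 0; first by rewrite size_poly0.
have := size_polyD A (- r); rewrite size_polyN {1}E addrK mulrC size_Mmonic //.
rewrite size_f addnS /=; move: q0; rewrite -size_poly_gt0.
by move: (size q) (size r) (size A) sr => x y z; lia.
Qed.

Lemma monic_expand m (A : {poly R}) : (size A <= m * N)%N ->
  exists a : nat -> {poly R},
    (forall l, (size (a l) <= N)%N) /\ A = \sum_(l < m) f ^+ l * a l.
Proof.
elim: m A => [|m IH] A sA.
  exists (fun=> 0); split=> [l|]; first by rewrite size_poly0.
  by rewrite big_ord0; apply/eqP; rewrite -size_poly_eq0 -leqn0 -(mul0n N).
have [Q [S [EA sS sQ]]] := monic_divide A.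
have [|a [sa EQ]] := IH Q; first by lia.
exists (fun l => if l is l'.+1 then a l' else S); split=> [[|l]|] //.
rewrite big_ord_recl /= mul1r EA addrC EQ mulr_sumr; congr (_ + _).
by apply: eq_bigr => l _; rewrite exprS mulrA.
Qed.
End Expansion.

(** * Passing from one chart to the next *)

Section Step.
Variable C : numClosedFieldType.
Variable n : nat.
Hypothesis n_gt0 : (0 < n)%N.
Implicit Types (Y F A B W : {poly {poly C}}) (P Q : {poly C}).

(** The order attached to a zero summand is arbitrary, so [cond] keeps such summands out of the
    minimum. *)
Lemma lead_min_sum (I : finType) (cond : pred I) (k : I -> nat)
    (Z : I -> {poly {poly C}}) (P : I -> {poly C}) (kmin : nat) :
  (forall i, cond i -> (kmin <= k i)%N) ->
  (forall i, cond i -> lead (k i) (Z i) (P i)) ->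
  (forall i, ~~ cond i -> Z i = 0) ->
  lead kmin (\sum_i Z i) (\sum_(i | cond i && (k i == kmin)) P i).
Proof.
move=> Hk HZ H0; rewrite (bigID cond) /= [X in _ + X]big1 // addr0.
rewrite big_mkcondr; apply: lead_sum => i ci.
case: eqP (HZ i ci) => [<- //|/eqP ne] /lead_up; apply.
by rewrite ltn_neqAle eq_sym ne Hk.
Qed.

(* In the chart [Y], the form [A dx + B dy] starts either with [p t^k dt/t] or
   with [q t^k (s u dt/t + du)] where [s > 0]. *)
Definition form_start Y A B (k : nat) (d : C * C * C) :=
  let: (p, q, s) := d in
  [/\ 0 < s, lead k (formH n Y A B) (p%:P + (s * q) *: 'X),
      lead k (formQ n Y B) q%:P, p * q = 0 &
      p = 0 -> q = 0 -> A = 0 /\ B = 0].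

Definition tame Y N := forall A B, (size A <= N)%N -> (size B <= N)%N ->
  exists k d, form_start Y A B k d.

Lemma lead_divXn (Z : {poly {poly C}}) m k p :
  lead k (Z * ('X^n *+ n)%:P * ('X^m)%:P) p%:P -> p != 0 ->
  exists2 l, k = (n + m + l)%N & lead l Z (p / n%:R)%:P.
Proof.
move=> H p0; have n0 : n%:R != 0 :> C by rewrite pnatr_eq0 -lt0n.
have L0 x : lead 0 (x%:P%:P : {poly {poly C}}) (x%:P).
  by exists x%:P%:P; rewrite ?mul1r // /at_t0 map_polyC /= horner_evalE hornerC.
have := leadM H (L0 n%:R^-1); rewrite -polyCM addn0.
have E : ('X^n *+ n) * 'X^m * (n%:R^-1)%:P = 'X^(n + m) :> {poly C}.
  rewrite -mulr_natl -polyC_natr exprD [in LHS]mulrC !mulrA -polyCM.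
  by rewrite mulVf // mul1r.
rewrite -!mulrA -!polyCM !mulrA E mulrC => /lead_cancelXn[|l Ek Hl].
  by rewrite polyC_eq0 mulf_neq0 ?invr_eq0.
by exists l.
Qed.

(** Tameness is applied to the form [F dx]: it has no [du] part, so it is of the first kind, and
    dividing by [n t^n] gives the leading term of [F]. *)
Lemma tame_const Y N F : tame Y N -> (size F <= N)%N ->
  exists k p, lead k (ev n Y F) p%:P /\ (p = 0 -> F = 0).
Proof.
move=> HY sF; have [|k [[[p q] s] [_ HH HQ _ H0]]] := HY F 0 sF.
  by rewrite size_poly0.
have q0 : q = 0.
  by have := coef_lead 0 HQ; rewrite coefC /= /formQ rmorph0 mul0r !coef0.
have [p0|p0] := eqVneq p 0.
  have [-> _] := H0 p0 q0; exists 0%N, 0; rewrite rmorph0; split=> //; exact: lead0.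
move: HH; rewrite q0 mulr0 scale0r addr0 /formH rmorph0 mul0r addr0.
rewrite -[X in lead _ X]mulr1 => /(@lead_divXn _ 0)[//|l _ Hl].
exists l, (p / n%:R); split=> // /eqP.
by rewrite mulf_eq0 (negPf p0) invr_eq0 pnatr_eq0 (gtn_eqF n_gt0).
Qed.

(* No function of [y]-degree less than [N] has order [K - n] in the chart [Y]. *)
Definition gap Y N K := forall F k p, (size F <= N)%N -> p != 0 ->
  lead k (ev n Y F) p%:P -> (k + n)%N != K.

Section Chart.
Variables (e b : nat) (Y : {poly {poly C}}).
Hypotheses (e_n : (e %| n)%N) (Y_cong : cong e b 0 Y) (Y_der : Y^`() = ('X^b)%:P).

Lemma cong_formQ B : cong e b b (formQ n Y B).
Proof.
rewrite -[b in cong _ _ b]add0n; apply: congM; first exact: cong_ev.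
rewrite Y_der; apply: congC => k; rewrite coefXn.
by case: (k =P b) => [-> //|]; rewrite eqxx.
Qed.

Lemma form_start_mod A B k p q s : form_start Y A B k (p, q, s) ->
  (p != 0 -> k = 0 %[mod e]) /\ (q != 0 -> k = b %[mod e]).
Proof.
case=> _ HH HQ _ _; split=> [p0|q0].
  have := cong_lead (m := 0) (cong_formH n_gt0 (A := A) (B := B) e_n Y_cong) HH.
  by rewrite coefD coefC coefZ coefX mulr0 addr0; apply.
by have := cong_lead (m := 0) (@cong_formQ B) HQ; rewrite coefC; apply.
Qed.

Variables (N nn bb : nat) (f : {poly {poly C}}) (g c : C).
Hypotheses (f_monic : f \is monic) (size_f : size f = N.+1).
Hypotheses (g0 : g != 0) (c0 : c != 0) (f_lead : lead bb (ev n Y f) (g *: 'X)).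
Hypothesis bb_mod : bb = b %[mod e].
Hypothesis nn_gt0 : (0 < nn)%N.
Hypothesis b_inj : forall l l', (l < nn)%N -> (l' < nn)%N ->
  l * b = l' * b %[mod e] -> l = l'.
Hypothesis nn_b : nn * b = 0 %[mod e].
Hypothesis Y_tame : tame Y N.

Lemma lead_fX l : lead (l * bb) (ev n Y (f ^+ l)) (g ^+ l *: 'X^l).
Proof. by rewrite rmorphXn /= -exprZn; apply: leadX. Qed.

Lemma bb_modM l k x : k = x %[mod e] -> k + l * bb = x + l * b %[mod e].
Proof. by move=> Hk; rewrite -modnDm Hk -modnMm bb_mod modnMm modnDm. Qed.

(* Write the form as a sum of [f^l] times forms of degree less than [N] in [y].
   The orders of the summands are [l b] or [(l + 1) b] modulo [e], according to
   their two possible shapes, so at most one summand of each shape contributes to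
   the leading part [P dt/t + Q du]. Either [P(c) <> 0], or these two cancel. *)
Lemma form_expand A B : (size A <= nn * N)%N -> (size B <= nn * N)%N ->
  (A != 0) || (B != 0) ->
  exists k P Q, [/\ lead k (formH n Y A B) P, lead k (formQ n Y B) Q &
    P.[c] != 0 \/ [/\ P.[c] = 0, Q.[c] != 0 &
                      exists2 s, 0 <= s & P^`().[c] = s * Q.[c]]].
Proof.
move=> sA sB AB0.
have [a [sa EA]] := monic_expand f_monic size_f sA.
have [a' [sa' EB]] := monic_expand f_monic size_f sB.
have [k Hk] := fin_all_exists (fun l : 'I_nn => Y_tame (sa l) (sa' l)).
have [d Hd] := fin_all_exists Hk.
pose p (l : 'I_nn) := (d l).1.1; pose q (l : 'I_nn) := (d l).1.2; pose s (l : 'I_nn) := (d l).2.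
have {Hk} Hd (l : 'I_nn) : form_start Y (a l) (a' l) (k l) (p l, q l, s l).
  by rewrite /p /q /s; case: (d l) (Hd l) => [[]].
pose cond (l : 'I_nn) := (p l != 0) || (q l != 0).
pose v (l : 'I_nn) := (k l + l * bb)%N.
have pmod l : p l != 0 -> v l = l * b %[mod e].
  by move=> pl; have [/(_ pl)/(bb_modM l)] := form_start_mod (Hd l).
have qmod l : q l != 0 -> v l = b + l * b %[mod e].
  by move=> ql; have [_ /(_ ql)/(bb_modM l)] := form_start_mod (Hd l).
have pq l : q l != 0 -> p l = 0.
  by move=> ql; have [_ _ _ /eqP] := Hd l; rewrite mulf_eq0 (negPf ql) orbF => /eqP.
have ncond l : ~~ cond l -> a l = 0 /\ a' l = 0.
  rewrite negb_or !negbK => /andP[/eqP pl /eqP ql].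
  by have [_ _ _ _] := Hd l; apply.
have [l0 cl0] : exists l, cond l.
  apply/existsP; apply: contraLR AB0 => /existsPn H.
  rewrite negb_or !negbK EA EB !big1 ?eqxx // => l _;
    by have [E1 E2] := ncond l (H l); rewrite ?E1 ?E2 mulr0.
case: (arg_minnP v cl0) => {cl0} l0 cl0 Hmin; set kk := v l0 in Hmin.
pose M l := cond l && (v l == kk).
have Ml0 : M l0 by rewrite /M cl0 eqxx.
have vM l : M l -> v l = kk by case/andP => _ /eqP.
pose P := \sum_(l | M l) (g ^+ l *: 'X^l) * ((p l)%:P + (s l * q l) *: 'X).
pose Q := \sum_(l | M l) (g ^+ l *: 'X^l) * (q l)%:P.
have HP : lead kk (formH n Y A B) P.
  rewrite EA EB formH_sum; apply: lead_min_sum => // l.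
    by move=> _; rewrite formH_M /v addnC; apply: leadM; [exact: lead_fX | case: (Hd l)].
  by case/ncond=> -> ->; rewrite !mulr0 /formH !rmorph0 !mul0r addr0.
have HQ : lead kk (formQ n Y B) Q.
  rewrite EB formQ_sum; apply: lead_min_sum => // l.
    by move=> _; rewrite formQ_M /v addnC; apply: leadM; [exact: lead_fX | case: (Hd l)].
  by case/ncond=> _ ->; rewrite mulr0 /formQ rmorph0 mul0r.
exists kk, P, Q; split=> //.
(* Without a summand of the second kind in minimal order, the orders [l * b] modulo [e] leave a
   single [l], and [P] is a monomial, nonzero at [c]. *)
have [/existsP[l1 /andP[Ml1 q1]]|/existsPn noq] :=
  boolP [exists l, M l && (q l != 0)]; last first.
  have q_0 l : M l -> q l = 0.
    by move=> Ml; apply/eqP; have := noq l; rewrite Ml /= negbK.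
  have p_0 l : M l -> p l != 0.
    by move=> Ml; case/andP: (Ml) => /orP[//|]; rewrite q_0 ?eqxx.
  left; rewrite /P (bigD1 l0) //= big1 ?addr0 => [|l /andP[Ml]].
    rewrite q_0 // mulr0 scale0r addr0 hornerM hornerZ hornerXn hornerC.
    by rewrite !mulf_neq0 ?expf_neq0 ?p_0.
  case/eqP; apply/val_inj/b_inj => //=.
  by rewrite -(pmod l) ?p_0 // -(pmod l0) ?p_0 // !vM.
have other l : M l -> l != l1 -> q l = 0 /\ l * b = b + l1 * b %[mod e].
  move=> Ml nl1; have ql : q l = 0.
    apply/eqP; apply: contraNT nl1 => ql; apply/eqP/val_inj/b_inj => //=.
    by apply/eqP; rewrite -(eqn_modDl b) -(qmod l) // -(qmod l1) // !vM.
  split=> //; rewrite -(qmod l1) // -(pmod l) ?vM //.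
  by case/andP: Ml => /orP[//|]; rewrite ql eqxx.
have EQ : Q = (g ^+ l1 * q l1) *: 'X^l1.
  rewrite /Q (bigD1 l1) //= big1 ?addr0 => [|l /andP[Ml /(other l Ml)[-> _]]].
    by rewrite mulrC mul_polyC scalerA mulrC.
  by rewrite mulr0.
pose x := g ^+ l1 * q l1.
have x0 : x != 0 by rewrite mulf_neq0 ?expf_neq0.
(* A summand of the first kind has [l * b = (l1 + 1) * b] modulo [e]. As [nn * b = 0], its index is
   [l1 + 1], or 0 when [l1 + 1 = nn]. *)
pose l2 := if (l1.+1 < nn)%N then l1.+1 else 0%N.
have [y EP] : exists y, P = (s l1 * x) *: 'X^(l1.+1) + y *: 'X^l2.
  exists (\sum_(l | M l && (l != l1)) g ^+ l * p l).
  rewrite /P (bigD1 l1) //= pq // add0r; congr (_ + _).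
    by rewrite -scalerAl -scalerAr scalerA -exprSr /x mulrCA.
  rewrite scaler_suml; apply: eq_bigr => l /andP[Ml nl1].
  have [-> El] := other l Ml nl1; rewrite mulr0 scale0r addr0 mulrC mul_polyC.
  rewrite scalerA mulrC; congr (_ *: 'X^_); apply: b_inj => //.
    by rewrite /l2; case: ifP.
  rewrite El -mulSn /l2; case: ltnP => // le.
  by rewrite (_ : l1.+1 = nn) ?nn_b ?mul0n //; apply/eqP; rewrite eqn_leq le ltn_ord.
have s1 : 0 < s l1 by case: (Hd l1).
have [Pc|] := eqVneq P.[c] 0; last by left.
have Qc : Q.[c] != 0 by rewrite EQ hornerZ hornerXn mulf_neq0 ?expf_neq0.
(* If [l1 + 1 < nn], [P] is a monomial vanishing at [c <> 0], hence zero, and the ratio is 0.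
   Otherwise [P] is a constant plus a multiple of [u^nn], and differentiating gives the ratio
   [s l1 * nn]. *)
right; split=> //; move: Pc EP; rewrite /l2; case: ltnP => [_|le] Pc EP.
  rewrite -scalerDl in EP; exists 0 => //.
  move/eqP: Pc; rewrite {1}EP hornerZ hornerXn mulf_eq0 expf_eq0 (negPf c0) andbF orbF.
  by move/eqP => E; rewrite EP E scale0r derivC horner0 mul0r.
exists (s l1 * nn%:R); first by rewrite mulr_ge0 ?ler0n ?ltW.
have E : nn%:R = l1.+1%:R :> C.
  by congr (_%:R); apply/eqP; rewrite eqn_leq le ltn_ord.
rewrite EP EQ expr0 derivD !derivZ derivXn derivC scaler0 addr0 /= E.
rewrite !hornerE -/x ?hornerMn ?hornerXn /x /= -!mulrA; congr (_ * _).
by rewrite ?mulrnAr ?mulr_natl; ring.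
Qed.

(** The terms of the expansion of [F] along powers of [f] have orders distinct modulo [e], so the
    least one gives the order of [F]. The forbidden order forces by congruence the index [nn - 1],
    whose coefficient would then have the order [K - n] excluded in the chart [Y]. *)
Lemma gap_step W K : at_t0 W = c%:P -> bb = (K + b)%N ->
  gap Y N K -> gap (Y \Po W) (nn * N)%N (nn * K + nn.-1 * b)%N.
Proof.
move=> HW Ebb HK F k p sF p0 HF.
have [a [sa EF]] := monic_expand f_monic size_f sF.
have [v0 Hv] := fin_all_exists (fun l : 'I_nn => tame_const Y_tame (sa l)).
have [r Hr] := fin_all_exists Hv; have {Hv} [Ha H0] := all_and2 Hr.
pose v (l : 'I_nn) := (v0 l + l * bb)%N.
have v0mod l : r l != 0 -> v0 l = 0 %[mod e].
  by have := cong_lead (m := 0) (cong_ev n_gt0 e_n Y_cong) (Ha l); rewrite coefC; apply.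
have [l0 rl0] : exists l, r l != 0.
  apply/existsP; apply: contraTT p0 => /existsPn H; rewrite negbK.
  have F0 : F = 0.
    rewrite EF big1 // => l _; rewrite (H0 l) ?mulr0 //.
    by apply/eqP; rewrite -[_ == _]negbK.
  by have := coef_lead 0 HF; rewrite F0 rmorph0 !coef0 coefC => /= ->.
case: (arg_minnP (P := fun l => r l != 0) v rl0) => {rl0} l0 rl0 Hmin.
have HZ : lead (v l0) (ev n Y F) ((g ^+ l0 *: 'X^l0) * (r l0)%:P).
  have <- : \sum_(l | (r l != 0) && (v l == v l0)) (g ^+ l *: 'X^l) * (r l)%:P =
      (g ^+ l0 *: 'X^l0) * (r l0)%:P.
    rewrite (bigD1 l0) ?rl0 ?eqxx //= big1 ?addr0 // => l.
    move=> /andP[/andP[rl /eqP El] /eqP nl]; case: nl; apply/val_inj/b_inj => //=.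
    have := bb_modM l (v0mod l rl); have := bb_modM l0 (v0mod l0 rl0).
    by rewrite -/(v l) -/(v l0) El => ->; rewrite !add0n.
  rewrite EF rmorph_sum; apply: lead_min_sum => // l.
    by move=> _; rewrite rmorphM /v addnC; apply: leadM; [exact: lead_fX | exact: Ha].
  by rewrite negbK => /eqP /H0 ->; rewrite mulr0 rmorph0.
have := lead_comp HZ HW; rewrite -ev_comp hornerM hornerZ hornerXn hornerC => HZc.
have [] := lead_uniq HF HZc; rewrite ?polyC_eq0 //.
  by rewrite !mulf_neq0 ?expf_neq0.
move=> Ek _; apply/eqP => E.
have K0 : K = 0 %[mod e] by apply/eqP; rewrite -(eqn_modDr b) -Ebb bb_mod add0n.
have El0 : l0 = nn.-1 :> nat.
  apply: b_inj; rewrite ?prednK //.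
  have := congr1 (modn^~ e) E; rewrite Ek -modnDm.
  rewrite (bb_modM l0 (v0mod l0 rl0)) (eqP e_n) add0n addn0 modn_mod => ->.
  have nK : nn * K = 0 %[mod e] by rewrite -modnMmr K0 mod0n muln0 mod0n.
  by rewrite -modnDm nK mod0n add0n modn_mod.
have /eqP[] := HK _ _ _ (sa l0) rl0 (Ha l0).
move: E; rewrite Ek /v El0 Ebb; move: nn_gt0; case: (nn) => // m _ /=.
rewrite mulSn mulnDr; move: (m * K)%N (m * b)%N (v0 l0) => x y z; clear.
by lia.
Qed.

End Chart.

Lemma gap0 Y : gap Y 1 0%N.
Proof. by move=> F k p _ _ _; rewrite addn_eq0 (gtn_eqF n_gt0) andbF. Qed.

Section Refine.
Variables (Y : {poly {poly C}}) (c : C) (W : {poly C}) (D e b : nat).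
Hypotheses (D_gt0 : (0 < D)%N) (W_c : W.[0] = c).
Let w := W%:P + ('X^D)%:P * 'X.
Hypotheses (e_n : (e %| n)%N) (e_b : ~~ (e %| b)%N).
Hypotheses (Yw_cong : cong e b 0 (Y \Po w)) (Yw_der : (Y \Po w)^`() = ('X^b)%:P).

Lemma at_t0_w : at_t0 w = c%:P.
Proof.
rewrite /w rmorphD rmorphM /= /at_t0 !map_polyC map_polyX /= !horner_evalE hornerXn.
by rewrite expr0n -(prednK D_gt0) mul0r addr0 W_c.
Qed.

Lemma deriv_w : w^`() = ('X^D)%:P.
Proof. by rewrite derivD derivM !derivC derivX mul0r !add0r mulr1. Qed.

(* Substituting [u = c + .. + t^D u'] turns [P dt/t + Q du] with [P(c) = 0] into
   an expression whose first [u']-dependent term is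
   [t^(k + D) ((P'(c) + D Q(c)) u' dt/t + Q(c) du')]; [s + D > 0] is the new ratio. *)
Lemma form_refine A B k P Q :
  lead k (formH n Y A B) P -> lead k (formQ n Y B) Q ->
  P.[c] != 0 \/ [/\ P.[c] = 0, Q.[c] != 0 &
                    exists2 s, 0 <= s & P^`().[c] = s * Q.[c]] ->
  exists k' d, form_start (Y \Po w) A B k' d.
Proof.
move=> HP HQ; have Hw := at_t0_w.
have Lw : lead 0 (theta w) 0 by exists (theta w); rewrite ?mul1r // at_t0_theta.
have LD : lead D ('X^D)%:P (1%:P : {poly C}).
  by exists 1; rewrite ?mulr1 // rmorph1.
have HQ2 : lead (k + D) (formQ n (Y \Po w) B) (Q.[c])%:P.
  rewrite formQ_comp deriv_w -[(Q.[c])%:P]mulr1.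
  by apply: leadM => //; apply: lead_comp.
case=> [Pc|[Pc Qc [s s0 Hs]]].
  exists k, (P.[c], 0, 1); split; rewrite ?mulr0 ?ltr01 //.
  - rewrite formH_comp scale0r; apply: leadD; first exact: lead_comp.
    rewrite -[k]addn0 -[0](mulr0 (Q.[c])%:P).
    by apply: leadM => //; apply: lead_comp.
  - by apply: lead_up HQ2 _; rewrite -[X in (X < _)%N]addn0 ltn_add2l.
  - by move/eqP; rewrite (negPf Pc).
set q := Q.[c] in Qc Hs HQ2; pose s' := s + D%:R; set H := formH n (Y \Po w) A B.
have s'0 : 0 < s' by rewrite ltr_wpDl // ltr0n.
have HH : lead (k + D) H^`() (s' * q)%:P.
  have -> : (s' * q)%:P = (P^`().[c])%:P * 1%:P + (Q^`().[c])%:P * 1%:P * 0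
      + q%:P * (1%:P *+ D).
    by rewrite Hs polyC1 mulr0 addr0 mulrnAr !mulr1 -polyCMn -polyCD /s' mulrDl mulr_natl.
  rewrite /H formH_comp derivD derivM !deriv_comp deriv_w addrA.
  have -> : (theta w)^`() = ('X^D)%:P *+ D.
    rewrite thetaD thetaC thetaM thetaX mulr0 addr0 derivD derivC add0r.
    by rewrite derivM derivX theta_Xn -polyCMn derivC mul0r add0r mulr1.
  apply: leadD; last first.
    apply: leadM; first exact: lead_comp.
    by rewrite -theta_Xn; apply: lead_theta.
  apply: leadD; first by apply: leadM => //; apply: lead_comp (lead_deriv HP) Hw.
  rewrite -[(k + D)%N]addn0; apply: leadM => //; apply: leadM => //.
  exact: lead_comp (lead_deriv HQ) Hw.
(* In characteristic 0 the derivative in [u] recovers every coefficient except the [u]-free part,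
   which is examined separately. *)
have Hm m l : H`_m.+1`_l = H^`()`_m`_l / m.+1%:R.
  by rewrite coef_deriv coefMn -[X in X / _]mulr_natr mulfK // pnatr_eq0.
have Hlow m l : (l < k + D)%N -> H`_m.+1`_l = 0.
  by move=> lt; rewrite Hm (proj2 (proj1 (leadP _ _ _) HH m)) ?mul0r.
(* A [u]-free term of order below [k + D] precedes everything else and puts the form in the first
   kind. *)
have [ex|nex] := boolP [exists l : 'I_(k + D), H`_0`_l != 0].
  have {}ex : exists l, (l < k + D)%N && (H`_0`_l != 0).
    by case/existsP: ex => l Hl; exists l; rewrite ltn_ord.
  case: (ex_minnP ex) => l /andP[lt Hl] Hmin.
  exists l, (H`_0`_l, 0, 1); split; rewrite ?mulr0 ?ltr01 //.
  - rewrite scale0r addr0; apply/leadP => -[|m]; rewrite coefC /=.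
      split=> // l' lt'; apply/eqP; apply: contraTT lt' => Hl'; rewrite -leqNgt.
      have [lt2|le] := ltnP l' (k + D); first by apply: Hmin; rewrite lt2.
      by apply: leq_trans le; apply: ltnW.
    by split=> [|l' lt']; rewrite Hlow // (ltn_trans lt').
  - exact: lead_up HQ2 lt.
  - by move/eqP; rewrite (negPf Hl).
have H0 l : (l < k + D)%N -> H`_0`_l = 0.
  move=> lt; apply/eqP; move/existsPn: nex => /(_ (Ordinal lt)) /=.
  by rewrite negbK.
(* The [du] part forces [k + D = b] modulo [e], whereas a [u]-free term of [H] has order divisible
   by [e]; [e] does not divide [b]. *)
have H0k : H`_0`_(k + D) = 0.
  apply/eqP; apply: contraNT e_b => Hk.
  have := cong_lead (m := 0) (cong_formQ e_n Yw_cong Yw_der (B := B)) HQ2.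
  rewrite coefC /= => /(_ Qc); rewrite mul0n add0n.
  have /= := cong_formH n_gt0 e_n Yw_cong Hk; rewrite mul0n addn0 => -> E.
  by rewrite /dvdn -E mod0n.
exists (k + D)%N, (0, q, s'); split=> //; last 2 first.
- by rewrite mul0r.
- by move=> _ /eqP; rewrite (negPf Qc).
rewrite add0r; apply/leadP => -[|m].
  by rewrite coefZ coefX mulr0 H0k; split=> // l /H0.
split; last by move=> l /Hlow.
rewrite Hm -(coef_lead m HH) coefZ coefX coefC eqSS.
by case: m => [|m] /=; rewrite ?mulr1 ?divr1 ?mulr0 ?mul0r.
Qed.

End Refine.

(** This chart refines the coordinate chart [y = u] by [u = t^b u']. There a form with coefficients
    depending on [x] alone pulls back to [p(t) dt/t + q(t) du], so [form_refine] applies with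
    [c = 0] and initial ratio 0. *)
Lemma tame_XnX b : (0 < b)%N -> ~~ (n %| b)%N -> tame (('X^b)%:P * 'X) 1.
Proof.
move=> b0 nb A B /size1_polyC -> /size1_polyC ->.
have Hp (p : {poly C}) : ev n 'X p%:P = (p \Po 'X^n)%:P.
  by rewrite /ev map_polyC /= comp_polyC.
set al := A`_0; set be := B`_0.
set p := (al \Po 'X^n) * ('X^n *+ n); set q := be \Po 'X^n.
have EH : formH n 'X al%:P be%:P = p%:P.
  by rewrite /formH thetaX mulr0 addr0 Hp -polyCM.
have EQ : formQ n 'X be%:P = q%:P by rewrite /formQ derivX mulr1 Hp.
have Xn0 : ('X^n : {poly C}) != 0 by rewrite expf_neq0 ?polyX_eq0.
have [pq0|] := boolP ((p == 0) && (q == 0)).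
  have comp0 (r : {poly C}) : r \Po 'X^n = 0 -> r = 0.
    by move=> r0; apply: (comp_Xn_inj n_gt0); rewrite r0 comp_poly0.
  exists 0%N, (0, 0, 1); case/andP: pq0 => /eqP p0 /eqP q0.
  have -> : be = 0 by apply: comp0.
  have -> : al = 0.
    apply: comp0; apply/eqP; move/eqP: p0; rewrite mulf_eq0 => /orP[//|].
    by rewrite -mulr_natr mulf_eq0 (negPf Xn0) -polyC_natr polyC_eq0 pnatr_eq0 gtn_eqF.
  rewrite rmorph0; split; rewrite ?ltr01 ?mulr0 ?scale0r ?add0r //.
    by rewrite /formH rmorph0 !mul0r addr0; exact: lead0.
  by rewrite /formQ rmorph0 mul0r; exact: lead0.
move=> pq0.
have ex : exists k, (p`_k != 0) || (q`_k != 0).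
  case/nandP: pq0 => H; [exists (size p).-1 | exists (size q).-1];
  by rewrite -!lead_coefE lead_coef_eq0 H ?orbT.
case: (ex_minnP ex) => k Hk Hmin.
have low l : (l < k)%N -> p`_l = 0 /\ q`_l = 0.
  move=> lt; have [|] := boolP ((p`_l != 0) || (q`_l != 0)).
    by move/Hmin; rewrite leqNgt lt.
  by rewrite negb_or !negbK => /andP[/eqP-> /eqP->].
have L (r : {poly C}) : (forall l, (l < k)%N -> r`_l = 0) -> lead k r%:P (r`_k)%:P.
  move=> H; apply/leadP=> m; rewrite !coefC; case: (m =P 0%N) => // _.
  by rewrite coef0; split=> // l; rewrite coef0.
have EX : 'X \Po (0%:P + ('X^b)%:P * 'X) = ('X^b)%:P * 'X :> {poly {poly C}}.
  by rewrite comp_polyX add0r.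
have := @form_refine 'X 0 0 b n b b0 (horner0 0) (dvdnn n) nb _ _
  al%:P be%:P k (p`_k)%:P (q`_k)%:P; rewrite EX EH EQ; apply.
- exact: cong_XnX.
- by rewrite derivM derivC derivX mul0r add0r mulr1.
- by apply: L => l /low[].
- by apply: L => l /low[].
- rewrite !hornerC; have [p0|] := eqVneq p`_k 0; last by left.
  right; move: Hk; rewrite p0 eqxx /= => qk; split=> //; exists 0 => //.
  by rewrite derivC horner0 mul0r.
Qed.
End Step.

Lemma prim_root_exists (C : numClosedFieldType) n :
  (0 < n)%N -> exists z : C, n.-primitive_root z.
Proof.
move=> n_gt0; pose p : {poly C} := 'X^n - 1.
have [r Dp] := closed_field_poly_normal p.
rewrite (monicP _) ?monicXnsubC // scale1r in Dp.
have rn1 : all n.-unity_root r by apply/allP=> z; rewrite -root_prod_XsubC -Dp.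
have sz_r : (n < (size r).+1)%N.
  by rewrite -(size_prod_XsubC r id) -Dp size_XnsubC.
have [|z] := hasP (has_prim_root n_gt0 rn1 _ sz_r); last by exists z.
by rewrite -separable_prod_XsubC -Dp separable_Xn_sub_1 // pnatr_eq0 -lt0n.
Qed.

Lemma big_nat_blocks (R : Type) (idx : R) (op : Monoid.law idx) m N (F : nat -> R) :
  \big[op/idx]_(0 <= k < m * N) F k =
  \big[op/idx]_(0 <= i < m) \big[op/idx]_(0 <= r < N) F (i * N + r)%N.
Proof.
elim: m => [|m IH]; first by rewrite mul0n !big_geq.
rewrite big_nat_recr //= -IH mulSn addnC (@big_cat_nat _ _ _ (m * N)) ?leq_addr //=.
congr (op _ _); rewrite -{1}[(m * N)%N]add0n big_addn addKn.
by apply: eq_bigr => i _; rewrite addnC.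
Qed.

(** * Arithmetic of the characteristic exponents, and the charts of the branch *)

Section Characteristic.
Variables (n g : nat) (b : nat -> nat).
Hypothesis n_gt0 : (0 < n)%N.

Local Notation E := (char_e n b).
(* Indices are shifted by one: level [i] concerns the exponent [b i.+1], [char_m i]
   is the paper's n_(i+1), and [char_K i] is betabar_(i+1) - beta_(i+1). *)
Definition char_m i := (E i %/ E i.+1)%N.
Definition char_N i := (n %/ E i)%N.
Fixpoint char_K i : nat :=
  if i is i'.+1 then (char_m i' * char_K i' + (char_m i').-1 * b i'.+1)%N else 0%N.

Lemma char_e_gt0 i : (0 < E i)%N.
Proof. by elim: i => [|i IH] //=; rewrite gcdn_gt0 IH. Qed.

Lemma char_e_dvdS i : (E i.+1 %| E i)%N.
Proof. exact: dvdn_gcdl. Qed.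

Lemma char_e_dvd i j : (i <= j)%N -> (E j %| E i)%N.
Proof.
move/subnK <-; elim: (j - i)%N => [|k IH]; first exact: dvdnn.
exact: dvdn_trans (char_e_dvdS _) IH.
Qed.

Lemma char_e_n i : (E i %| n)%N.
Proof. exact: (@char_e_dvd 0). Qed.

Lemma char_mE i : (char_m i * E i.+1)%N = E i.
Proof. exact/divnK/char_e_dvdS. Qed.

Lemma char_NE i : (char_N i * E i)%N = n.
Proof. exact/divnK/char_e_n. Qed.

Lemma char_m_gt0 i : (0 < char_m i)%N.
Proof. by rewrite divn_gt0 ?char_e_gt0 // dvdn_leq ?char_e_gt0 ?char_e_dvdS. Qed.

Lemma char_N_gt0 i : (0 < char_N i)%N.
Proof. by rewrite divn_gt0 ?char_e_gt0 // dvdn_leq ?char_e_n. Qed.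

Lemma char_NS i : char_N i.+1 = (char_m i * char_N i)%N.
Proof.
apply/eqP; rewrite -(eqn_pmul2r (char_e_gt0 i.+1)) char_NE mulnAC char_mE.
by rewrite mulnC char_NE.
Qed.

(** As [E i.+1] is the gcd of [E i] and [b i.+1], the class of [b i.+1] modulo [E i] has additive
    order [char_m i]. *)
Lemma char_m_dvd i k : (E i %| k * b i.+1)%N = (char_m i %| k)%N.
Proof.
apply/idP/idP => H; last first.
  by rewrite -char_mE; apply: dvdn_mul => //; apply: dvdn_gcdr.
rewrite -(dvdn_pmul2r (char_e_gt0 i.+1)) char_mE /= muln_gcdr dvdn_gcd H.
by rewrite dvdn_mull.
Qed.

Lemma char_mul_inj i l l' : (l < char_m i)%N -> (l' < char_m i)%N ->
  l * b i.+1 = l' * b i.+1 %[mod E i] -> l = l'.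
Proof.
wlog le : l l' / (l <= l')%N.
  by move=> W; case: (leqP l l') => [|/ltnW] le h h' H; [|symmetry]; apply: W.
move=> _ lt /esym/eqP; rewrite eqn_mod_dvd ?leq_mul2r ?le ?orbT //.
rewrite -mulnBl char_m_dvd => dv; apply/eqP; rewrite eqn_leq le /= -subn_eq0.
by apply: contraLR lt => nz; rewrite -leqNgt (leq_trans _ (leq_subr l l')) // dvdn_leq // lt0n.
Qed.

Lemma char_K_dvd i : (E i %| char_K i)%N.
Proof.
elim: i => [|i IH]; first exact: dvdn0.
rewrite /char_K -/char_K; apply: dvdn_add; apply: dvdn_mull.
  exact: dvdn_trans (char_e_dvdS i) IH.
exact: dvdn_gcdr.
Qed.

(** Monotonicity of [b] keeps the truncated subtraction in [betabar] exact. *)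
Lemma betabarE i : (forall j, (j < i)%N -> (b j.+1 <= b j.+2)%N) ->
  betabar n b i.+1 = (char_K i + b i.+1)%N.
Proof.
elim: i => [//|i IH] mono.
have -> : betabar n b i.+2 = (char_m i * betabar n b i.+1 + b i.+2 - b i.+1)%N by [].
rewrite IH => [|j lt]; last by apply: mono; apply: ltnW.
have := mono i (ltnSn i); rewrite /char_K -/char_K; have := char_m_gt0 i.
case: (char_m i) => // m _ /=; rewrite mulnDr [(m.+1 * b _)%N]mulSn.
by move: (m.+1 * char_K i)%N (m * b i.+1)%N => x y; lia.
Qed.

Variables (C : numClosedFieldType) (a : nat -> C).
Hypothesis b_char : char_exps n a g b.

Lemma b_neq0 i : (i < g)%N -> a (b i.+1) != 0.
Proof. by move=> lt; have [] := proj1 b_char i.+1 lt. Qed.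

Lemma b_ndvd i : (i < g)%N -> ~~ (E i %| b i.+1)%N.
Proof. by move=> lt; have [] := proj1 b_char i.+1 lt. Qed.

Lemma a_dvd i k : (i < g)%N -> (k < b i.+1)%N -> a k != 0 -> (E i %| k)%N.
Proof. by move=> lt; have [_ _] := proj1 b_char i.+1 lt; apply. Qed.

(** A later exponent lying below [b i.+1] would be divisible by [E i], and one equal to it by
    [E i.+1]; in both cases by [E j], which is excluded. *)
Lemma b_lt i j : (i < j)%N -> (j < g)%N -> (b i.+1 < b j.+1)%N.
Proof.
move=> ltij ltjg; have ltig := ltn_trans ltij ltjg.
case: (ltngtP (b i.+1) (b j.+1)) => // [lt|eq]; move: (b_ndvd ltjg).
  by rewrite (dvdn_trans (char_e_dvd (ltnW ltij))) // a_dvd ?b_neq0.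
by rewrite -eq (dvdn_trans (char_e_dvd ltij)) // dvdn_gcdr.
Qed.

Definition psi m : {poly C} := \poly_(k < m) a k.
Definition chart i : {poly {poly C}} := (psi (b i.+1))%:P + ('X^(b i.+1))%:P * 'X.

Lemma deriv_chart i : (chart i)^`() = ('X^(b i.+1))%:P.
Proof. by rewrite derivD derivM !derivC derivX mul0r !add0r mulr1. Qed.

Lemma cong_chart i : (i < g)%N -> cong (E i) (b i.+1) 0 (chart i).
Proof.
move=> lt; apply: congD; last exact: cong_XnX.
apply: congC0 => k; rewrite coef_poly.
by case: ltnP => [lk|_]; [exact: a_dvd | rewrite eqxx].
Qed.

(** * Semiroots as products over conjugates *)

Section Semiroot.
Variables (z : C) (i : nat).
Hypotheses (z_prim : n.-primitive_root z) (i_g : (i < g)%N).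
Let ps := psi (b i.+1).

(** The Galois action [t -> z^k t], which fixes [x = t^n]. *)
Definition rot k (p : {poly C}) := p \Po (z ^+ k *: 'X).

Lemma coef_rot k p m : (rot k p)`_m = z ^+ (k * m) * p`_m.
Proof.
rewrite /rot comp_polyE coef_sum.
under eq_bigr => j _ do rewrite exprZn -exprM coefZ coefZ coefXn.
have [lt|le] := ltnP m (size p).
  rewrite (bigD1 (Ordinal lt)) //= eqxx mulr1 mulrC big1 ?addr0 // => j.
  by rewrite -val_eqE eq_sym /= => /negPf ->; rewrite !mulr0.
rewrite nth_default // mulr0 big1 // => j _.
by rewrite gtn_eqF ?mulr0 // (leq_trans (ltn_ord j) le).
Qed.

HB.instance Definition _ k := GRing.RMorphism.copy (rot k) (comp_poly (z ^+ k *: 'X)).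

Lemma rot_rot k l p : rot k (rot l p) = rot (k + l) p.
Proof. by apply/polyP=> m; rewrite !coef_rot mulrA -exprD -mulnDl. Qed.

Lemma rot0 p : rot 0 p = p.
Proof. by apply/polyP=> m; rewrite coef_rot mul0n mul1r. Qed.

Lemma rot_psi : rot (char_N i) ps = ps.
Proof.
apply/polyP=> m; rewrite coef_rot; have [->|pm] := eqVneq ps`_m 0; first by rewrite mulr0.
rewrite (_ : z ^+ _ = 1) ?mul1r //; apply/eqP; rewrite -(prim_order_dvd z_prim).
rewrite -(char_NE i) dvdn_mul //; move: pm; rewrite coef_poly.
by case: ltnP => [lt|]; [apply: a_dvd | rewrite eqxx].
Qed.

Lemma rot_fix p : rot 1 p = p -> exists q, q \Po 'X^n = p.
Proof.
move=> Hp; exists (\poly_(k < size p) p`_(k * n)); apply/polyP=> m.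
rewrite coef_comp_poly_Xn // coef_poly; case: (boolP (n %| m)%N) => [dv|ndv].
  rewrite divnK //; case: ltnP => // le; rewrite nth_default //.
  by apply: leq_trans le _; apply: leq_div.
have := congr1 (fun q : {poly C} => q`_m) Hp; rewrite coef_rot mul1n => /eqP.
rewrite -{2}[p`_m]mul1r -subr_eq0 -mulrBl mulf_eq0 subr_eq0.
by rewrite -(prim_order_dvd z_prim) (negPf ndv) => /eqP.
Qed.

Definition conj_prod : {poly {poly C}} := \prod_(k < char_N i) ('X - (rot k ps)%:P).

(** [rot 1] permutes the factors cyclically, [rot_psi] closing the cycle. The coefficients are thus
    fixed by the rotation, hence polynomials in [t^n]. *)
Lemma conj_prod_descent : exists f, map_poly (comp_poly 'X^n) f = conj_prod.
Proof.
have Hrot : map_poly (rot 1) conj_prod = conj_prod.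
  rewrite rmorph_prod /=.
  under eq_bigr => k _ do rewrite rmorphB /= map_polyX map_polyC /= rot_rot.
  have := char_N_gt0 i; rewrite /conj_prod; case EN: (char_N i) => [//|N] _.
  rewrite big_ord_recr big_ord_recl /= mulrC rot0; congr (_ * _).
  by rewrite add1n -EN rot_psi.
have Hc m : exists q, q \Po 'X^n = conj_prod`_m.
  by apply: rot_fix; rewrite -{2}Hrot coef_map.
have [q Hq] := fin_all_exists (fun m : 'I_(size conj_prod) => Hc m).
exists (\sum_m (q m)%:P * 'X^m).
rewrite rmorph_sum -[RHS]coefK poly_def; apply: eq_bigr => m _.
by rewrite rmorphM /= map_polyC map_polyXn /= Hq mul_polyC.
Qed.

Definition conj_diff k : {poly {poly C}} := chart i - (rot k ps)%:P.

(** Exponents of the branch below [b q.+1] are multiples of [E q], so rotation by such a [k] fixes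
    their terms, [n] being [char_N q * E q]. The term of exponent [b q.+1] is the first one that it
    moves. *)
Lemma conj_diff_lead q k : (q < i)%N -> (char_N q %| k)%N ->
  ~~ (char_N q.+1 %| k)%N ->
  exists2 x, x != 0 & lead (b q.+1) (conj_diff k) x%:P.
Proof.
move=> lt_qi dv ndv; have lt_qg := ltn_trans lt_qi i_g.
have lt_b : (b q.+1 < b i.+1)%N by apply: b_lt.
exists (a (b q.+1) * (1 - z ^+ (k * b q.+1))).
  rewrite mulf_neq0 ?b_neq0 // subr_eq0 eq_sym -(prim_order_dvd z_prim).
  apply: contra ndv => /=; rewrite -{1}(char_NE q) char_NS; case/dvdnP: dv => k' ->.
  by rewrite mulnAC dvdn_pmul2r ?char_N_gt0 // mulnC dvdn_pmul2r ?char_N_gt0 // char_m_dvd.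
have coef0E l : (l <= b q.+1)%N -> (conj_diff k)`_0`_l = a l * (1 - z ^+ (k * l)).
  move=> le; have lt := leq_ltn_trans le lt_b.
  rewrite /conj_diff /chart !coefB !coefD !coefC coefCM coefX mulr0 coef0 addr0 /=.
  by rewrite coef_rot !coef_poly lt mulrBr mulr1 [in RHS]mulrC.
have coefSE m l : (l <= b q.+1)%N -> (conj_diff k)`_m.+1`_l = 0.
  move=> le; rewrite /conj_diff /chart !coefB !coefD !coefC coefCM coefXnM /=.
  by rewrite (leq_ltn_trans le lt_b) !if_same addr0 subr0.
apply/leadP=> -[|m]; rewrite coefC /=; last first.
  by rewrite coefSE //; split=> // l lt; rewrite coefSE // ltnW.
split=> [|l lt]; first by rewrite (coef0E _ (leqnn _)).
rewrite (coef0E _ (ltnW lt)).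
have [->|al] := eqVneq (a l) 0; first by rewrite mul0r.
rewrite (_ : z ^+ _ = 1) ?subrr ?mulr0 //; apply/eqP.
by rewrite -(prim_order_dvd z_prim) -(char_NE q) dvdn_mul // a_dvd.
Qed.

(* The shift [s] makes the range run over an arbitrary system of representatives
   modulo [char_N q], which is what the induction needs. *)
Definition shifted_diff q (s : nat -> nat) (k : nat) : {poly {poly C}} :=
  if k == 0%N then 1 else conj_diff (k + char_N q * s k).

(** The residues modulo [char_N q.+1] split into [char_m q] blocks of length [char_N q]. By
    induction each block gives [char_K q] from its indices other than the first; the first index of
    each block but the initial one adds [b q.+1]. This is the recursion of [char_K]. *)
Lemma shifted_diff_prod q : (q <= i)%N -> forall s : nat -> nat,
  exists2 x, x != 0 &
    lead (char_K q) (\prod_(0 <= k < char_N q) shifted_diff q s k) x%:P.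
Proof.
elim: q => [|q IH] lt_qi s.
  exists 1; rewrite ?oner_eq0 // /char_N divnn n_gt0 big_nat1 /shifted_diff /=.
  by exists 1; rewrite ?mulr1 // rmorph1.
have N_gt0 := char_N_gt0 q.
pose o (r : nat) := (char_K q + (r != 0%N) * b q.+1)%N.
have H (r : 'I_(char_m q)) : exists x, x != 0 /\
    lead (o r) (\prod_(0 <= k < char_N q) shifted_diff q.+1 s (r * char_N q + k)) x%:P.
  (* Chosen so that [k + char_N q * s' k] is the shifted index at position [r * char_N q + k] one
     level up. *)
  pose s' k := (r + char_m q * s (r * char_N q + k))%N.
  have [x x0] := IH (ltnW lt_qi) s'.
  rewrite !(big_ltn N_gt0) addn0 {1}/shifted_diff eqxx mul1r => Hx.
  have Hrest : lead (char_K q)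
      (\prod_(1 <= k < char_N q) shifted_diff q.+1 s (r * char_N q + k)) x%:P.
    rewrite (eq_big_nat _ _ (F2 := shifted_diff q s')) // => k /andP[k0 _].
    rewrite /shifted_diff addn_eq0 (gtn_eqF k0) andbF; congr conj_diff.
    by rewrite char_NS /s'; ring.
  have [r0|r0] := eqVneq (nat_of_ord r) 0%N.
    have -> : o r = char_K q by rewrite /o r0 addn0.
    by exists x; rewrite {1}/shifted_diff muln_eq0 (introT eqP r0) /= mul1r.
  have [||y y0 Hy] := @conj_diff_lead q
    (r * char_N q + char_N q.+1 * s (r * char_N q))%N lt_qi.
  - by rewrite char_NS; apply: dvdn_add; [exact: dvdn_mull | by rewrite dvdn_mulr // dvdn_mull].
  - rewrite (dvdn_addl _ (dvdn_mulr _ (dvdnn _))) char_NS dvdn_pmul2r //.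
    by apply: contraL (ltn_ord r) => /dvdn_leq; rewrite -leqNgt lt0n; apply.
  exists (y * x); split; first by rewrite mulf_neq0.
  rewrite /o r0 mul1n addnC polyCM {1}/shifted_diff muln_eq0 (negPf r0) (gtn_eqF N_gt0).
  exact: leadM.
have [x /all_and2[x0 Hx]] := fin_all_exists H.
exists (\prod_r x r); first by apply/prodf_neq0.
have := lead_prod (index_enum _) (fun r (_ : true) => Hx r).
rewrite char_NS big_nat_blocks big_mkord.
suff -> : (\sum_(r < char_m q) o r)%N = char_K q.+1 by [].
rewrite big_split /= sum_nat_const card_ord -big_distrl /=; congr (_ + _ * _)%N.
have := char_m_gt0 q; case: (char_m q) => // m _.
by rewrite big_ord_recl /= add0n sum_nat_const card_ord muln1.
Qed.

(* The product of the conjugates of the truncated branch under t -> z t. *)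
Lemma semiroot : exists f g0, [/\ f \is monic, size f = (char_N i).+1, g0 != 0 &
  lead (char_K i + b i.+1) (ev n (chart i) f) (g0 *: 'X)].
Proof.
have [f Hf] := conj_prod_descent.
have monicP : conj_prod \is monic by rewrite monic_prod_XsubC.
have sizeP : size conj_prod = (char_N i).+1.
  by rewrite size_prod_XsubC [index_enum _]unlock -enumT size_enum_ord.
have comp0 : comp_poly ('X^n) (0 : {poly C}) = 0 by rewrite comp_poly0.
have [x x0 Hx] := shifted_diff_prod (leqnn i) (fun=> 0%N).
exists f, x; split=> //.
- apply/eqP/(comp_Xn_inj n_gt0); rewrite -(lead_coef_map_inj (comp_Xn_inj n_gt0)) //.
  by rewrite Hf (eqP monicP) /= comp_polyC.
- by rewrite -sizeP -Hf size_map_inj_poly //; exact: comp_Xn_inj.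
have -> : ev n (chart i) f = \prod_(k < char_N i) conj_diff k.
  rewrite /ev Hf rmorph_prod /=; apply: eq_bigr => k _.
  by rewrite comp_polyB comp_polyX comp_polyC.
(* The factor of index 0 is [t^(b i.+1) u]; the others contribute the order [char_K i] and a nonzero
   constant. *)
rewrite [(char_K i + _)%N]addnC -(big_mkord xpredT) big_ltn ?char_N_gt0 //.
have L0 : lead (b i.+1) (conj_diff 0) 'X.
  rewrite /conj_diff rot0 /chart addrAC subrr add0r; exists 'X => //.
  by rewrite /at_t0 map_polyX.
rewrite -mul_polyC [x%:P * _]mulrC; apply: (leadM L0).
move: Hx; rewrite big_ltn ?char_N_gt0 // {1}/shifted_diff eqxx mul1r.
rewrite (eq_big_nat _ _ (F2 := conj_diff)) // => k /andP[k0 _].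
by rewrite /shifted_diff gtn_eqF // muln0 addn0.
Qed.

End Semiroot.

(** * Induction along the charts and the excluded factorization *)

Lemma poly_chart_shift l m : (l < m)%N ->
  psi m = psi l + 'X^l * \poly_(k < m - l) a (k + l).
Proof.
move=> lt; apply/polyP=> k; rewrite coefD coefXnM !coef_poly.
case: (ltnP k l) => [ltkl|le]; first by rewrite (ltn_trans ltkl lt) addr0.
by rewrite add0r subnK // ltn_sub2rE.
Qed.

Hypotheses (g_gt0 : (0 < g)%N) (b1_gt0 : (0 < b 1)%N).
Hypothesis a_low : forall k, (k < b 1)%N -> a k = 0.

Lemma chart0E : chart 0 = ('X^(b 1))%:P * 'X.
Proof.
rewrite /chart (_ : psi _ = 0) ?add0r //.
by apply/polyP=> k; rewrite coef_poly coef0; case: ltnP => // /a_low.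
Qed.

Lemma chart_comp i (W : {poly C}) (V : {poly {poly C}}) :
  chart i \Po (W%:P + V) = (psi (b i.+1) + 'X^(b i.+1) * W)%:P + ('X^(b i.+1))%:P * V.
Proof.
rewrite /chart comp_polyD comp_polyM !comp_polyC comp_polyX mulrDr addrA.
by rewrite polyCD polyCM.
Qed.

Lemma char_K_mod i : char_K i + b i.+1 = b i.+1 %[mod char_e n b i].
Proof. by rewrite -modnDm (eqP (char_K_dvd i)) add0n modn_mod. Qed.

(** By induction: [form_expand] in one chart followed by [form_refine] gives tameness in the next,
    and [gap_step] carries the gap along. *)
Lemma chart_tame_gap i : (i < g)%N ->
  tame n (chart i) (char_N i) /\ gap n (chart i) (char_N i) (char_K i).
Proof.
elim: i => [|i IH] lt.
  rewrite /char_N /= divnn n_gt0; split; last exact: gap0.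
  by rewrite chart0E; apply: tame_XnX => //; apply: (b_ndvd g_gt0).
have lti := ltnW lt; have {IH} [Ht Hg] := IH lti.
have [z z_prim] := prim_root_exists C n_gt0.
have [f [g0 [f_monic size_f g00 f_lead]]] := semiroot z_prim lti.
have lb := b_lt (ltnSn i) lt; set D := (b i.+2 - b i.+1)%N.
have D_gt0 : (0 < D)%N by rewrite subn_gt0.
(* [W] holds the terms of the branch with exponents from [b i.+1] up to [b i.+2], excluded, divided
   by [t^(b i.+1)]; setting [u = W + t^D u'] turns [chart i] into [chart i.+1]. *)
pose W : {poly C} := \poly_(k < D) a (k + b i.+1).
have Wc : W.[0] = a (b i.+1) by rewrite horner_coef0 coef_poly D_gt0.
have EY : chart i.+1 = chart i \Po (W%:P + ('X^D)%:P * 'X).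
  rewrite chart_comp -poly_chart_shift // mulrA -polyCM -exprD subnKC //.
  exact: ltnW.
have nn_b : char_m i * b i.+1 = 0 %[mod char_e n b i].
  by apply/eqP; rewrite mod0n -/(dvdn _ _) char_m_dvd.
split; rewrite char_NS; last first.
  rewrite EY; apply: (gap_step n_gt0 (char_e_n i) (cong_chart lti) f_monic
    size_f g00 (b_neq0 lti) f_lead (char_K_mod i) (char_m_gt0 i)
    (@char_mul_inj i) Ht _ _ Hg) => //.
  exact: at_t0_w.
move=> A B sA sB; have [AB0|] := boolP ((A != 0) || (B != 0)); last first.
  rewrite negb_or !negbK => /andP[/eqP -> /eqP ->].
  exists 0%N, (0, 0, 1); split; rewrite ?ltr01 ?mulr0 ?scale0r ?add0r ?rmorph0 //.
    by rewrite /formH rmorph0 !mul0r addr0; exact: lead0.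
  by rewrite /formQ rmorph0 mul0r; exact: lead0.
have [k [P [Q [HP HQ HPQ]]]] := form_expand n_gt0 (char_e_n i) (cong_chart lti)
  (deriv_chart i) f_monic size_f g00 (b_neq0 lti) f_lead (char_K_mod i)
  (char_m_gt0 i) (@char_mul_inj i) nn_b Ht sA sB AB0.
rewrite EY; apply: (form_refine n_gt0 D_gt0 Wc (char_e_n i.+1) (b_ndvd lt) _ _ HP HQ HPQ).
  by rewrite -EY; exact: cong_chart.
by rewrite -EY; exact: deriv_chart.
Qed.

(** A multiple of [F] has order at least [bb > k], so removing it leaves the term of order [k]
    unchanged. *)
Lemma lead_reduce (F Z2 Z1 : {poly {poly C}}) bb k P P' :
  lead bb F P -> (k < bb)%N -> lead k (F * Z2 + Z1) P' -> lead k Z1 P'.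
Proof.
move=> HF lt H; have HZ : lead bb (F * Z2) (P * at_t0 Z2).
  by rewrite -[bb]addn0; apply: leadM => //; exists Z2; rewrite ?mul1r.
have := leadD H (leadN (lead_up HZ lt)).
by rewrite oppr0 addr0 addrAC subrr add0r.
Qed.

(* The branch is [chart i] at [u = W]. The contradiction comes from [w /\ dF], whose
   coefficient [A F_y - B F_x] would have order [char_K i - n]. *)
Lemma no_factorization i (W : {poly C}) A B F s t p q : (i < g)%N ->
  W.[0] = a (b i.+1) -> let Y := chart i \Po W%:P in
  (0 < s)%N -> (0 < t)%N -> p != 0 -> q != 0 ->
  lead s (ev n Y F) p%:P -> lead t (formH n Y A B) q%:P ->
  (s + t)%N != betabar n b i.+1.
Proof.
move=> lt Wc Y s0 t0 p0 q0 HF HAB; apply/eqP.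
rewrite betabarE => [|j ltji]; last by rewrite ltnW // b_lt // (leq_ltn_trans ltji).
move=> Est; have [Ht Hg] := chart_tame_gap lt.
have [z z_prim] := prim_root_exists C n_gt0.
have [f [g0 [f_monic size_f g00 f_lead]]] := semiroot z_prim lt.
have HW : at_t0 W%:P = (a (b i.+1))%:P.
  by rewrite /at_t0 map_polyC /= horner_evalE Wc.
have f_leadY : lead (char_K i + b i.+1) (ev n Y f) (g0 * a (b i.+1))%:P.
  by have := lead_comp f_lead HW; rewrite -ev_comp hornerZ hornerX.
(* Both [s] and [t] are positive, hence less than the order of [f] on the branch, so remainders
   modulo [f] keep the leading terms. *)
have [A2 [A1 [EA sA _]]] := monic_divide f_monic size_f A.
have [B2 [B1 [EB sB _]]] := monic_divide f_monic size_f B.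
have [F2 [F1 [EF sF _]]] := monic_divide f_monic size_f F.
have {HAB} HAB : lead t (formH n Y A1 B1) q%:P.
  move: HAB; rewrite EA EB formHD formH_M; apply: lead_reduce f_leadY _.
  by rewrite -Est -[X in (X < _)%N]add0n ltn_add2r.
have {HF} HF : lead s (ev n Y F1) p%:P.
  move: HF; rewrite EF rmorphD rmorphM /=; apply: lead_reduce f_leadY _.
  by rewrite -Est -[X in (X < _)%N]addn0 ltn_add2l.
have [k1 [p1 [HF1 p1F]]] := tame_const n_gt0 Ht sF.
have p10 : p1 != 0.
  apply: contraNneq p0 => /p1F F0; have := coef_lead 0 HF.
  by rewrite F0 rmorph0 !coef0 coefC => /= ->.
have HF1Y := lead_comp HF1 HW; rewrite -ev_comp hornerC -/Y in HF1Y.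
have [Es _] : s = k1 /\ p%:P = p1%:P by apply: lead_uniq HF HF1Y _ _; rewrite polyC_eq0.
have smod : s = 0 %[mod char_e n b i].
  have := cong_lead (m := 0) (cong_ev n_gt0 (char_e_n i) (cong_chart lt)) HF1.
  by rewrite coefC Es; apply.
have [k [[[r x] sg] Hd]] := Ht A1 B1 sA sB.
have [kr kx] := form_start_mod n_gt0 (char_e_n i) (cong_chart lt) (deriv_chart i) Hd.
case: Hd => sg0 HH HQ rx0 AB0.
have HHY : lead k (formH n Y A1 B1) (r + sg * x * a (b i.+1))%:P.
  rewrite formH_comp -[(r + _)%:P](addr0) -(mulr0 x%:P); apply: leadD.
    by have := lead_comp HH HW; rewrite hornerD hornerC hornerZ hornerX.
  rewrite -[k]addn0; apply: leadM.
    by have := lead_comp HQ HW; rewrite hornerC.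
  by exists (theta W%:P); rewrite ?mul1r // at_t0_theta.
(* For a form of the first kind both [t] and [s] are divisible by [char_e n b i], but their sum is
   congruent to [b i.+1], which is not. *)
have [x0|x0] := eqVneq x 0.
  have r0 : r != 0.
    apply: contraNneq q0 => r0; have [A0 B0] := AB0 r0 x0.
    have := coef_lead 0 HAB; rewrite A0 B0 /formH rmorph0 !mul0r addr0 !coef0 coefC.
    by move=> /= ->.
  have [Etk _] : t = k /\ q%:P = (r + sg * x * a (b i.+1))%:P.
    by apply: lead_uniq HAB HHY _ _; rewrite polyC_eq0 // x0 mulr0 mul0r addr0.
  have : (s + t)%N = b i.+1 %[mod char_e n b i] by rewrite Est char_K_mod.
  rewrite -modnDm smod Etk (kr r0) !mod0n => /esym/eqP H.
  by have := b_ndvd lt; rewrite /dvdn H.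
have r0 : r = 0 by move/eqP: rx0; rewrite mulf_eq0 (negPf x0) orbF => /eqP.
have [Etk _] : t = k /\ q%:P = (r + sg * x * a (b i.+1))%:P.
  apply: lead_uniq HAB HHY _ _; rewrite polyC_eq0 // r0 add0r.
  by rewrite !mulf_neq0 ?b_neq0 // gt_eqF.
(* [F1] starts with a constant in [u], so its [u]-derivative contributes 0 in this order, and the
   wedge starts with [- x p1 s t^(s + t)], nonzero as [s > 0]. *)
have := leadD (leadM HH (lead_deriv HF1)) (leadN (leadM HQ (lead_theta HF1))).
rewrite formH_wedge // deriv_chart derivC mulr0 add0r -Etk -Es addnC Est.
rewrite -polyCMn -polyCM -polyCN; set y := - (x * _) => HG.
have y0 : y != 0 by rewrite /y oppr_eq0 mulf_eq0 mulrn_eq0 (negPf x0) (negPf p10) (gtn_eqF s0).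
have [l El Hl] := lead_divXn n_gt0 HG y0.
have EK : (l + n)%N = char_K i.
  by move: El; rewrite [RHS]addnC addnA => /eqP; rewrite eqn_add2r => /eqP ->.
(* [G] may exceed the degree bound of the gap; its order [char_K i - n] is below that of [f], so its
   remainder has the same leading term. *)
set G := _ - _ in Hl; have [G2 [G1 [EG sG _]]] := monic_divide f_monic size_f G.
have HG1 : lead l (ev n (chart i) G1) (y / n%:R)%:P.
  move: Hl; rewrite EG rmorphD rmorphM /=; apply: lead_reduce f_lead _.
  rewrite -EK -addnA -[X in (X < _)%N]addn0 ltn_add2l addn_gt0 n_gt0 //.
have yn0 : y / n%:R != 0 by rewrite mulf_neq0 // invr_eq0 pnatr_eq0 -lt0n.
by have := Hg _ _ _ sG yn0 HG1; rewrite EK eqxx.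
Qed.

End Characteristic.

(** * From power series to polynomials by truncation *)

Section Series.
Variable C : numClosedFieldType.
Variables (n : nat) (a : nat -> C).
Hypotheses (n_gt0 : (0 < n)%N) (a0 : a 0%N = 0).

Definition agree M (h : nat -> C) (p : {poly C}) :=
  forall k, (k < M)%N -> h k = p`_k.

Lemma agree_smul M h1 h2 p1 p2 :
  agree M h1 p1 -> agree M h2 p2 -> agree M (smul h1 h2) (p1 * p2).
Proof.
move=> H1 H2 k lt; rewrite coefM; apply: eq_bigr => l _.
have le := ltn_ord l; rewrite ltnS in le.
by rewrite H1 ?H2 // (leq_ltn_trans _ lt) // leq_subr.
Qed.

Lemma agree_spow M h p j : agree M h p -> agree M (spow h j) (p ^+ j).
Proof.
move=> H; elim: j => [|j IH]; first by move=> k _; rewrite expr0 coef1.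
by rewrite exprS; apply: agree_smul.
Qed.

Lemma agree_tpow M m : agree M (tpow C m) 'X^m.
Proof. by move=> k _; rewrite coefXn. Qed.

Lemma agree_psi M : agree M a (psi a M).
Proof. by move=> k lt; rewrite coef_poly lt. Qed.

Lemma agree_sderiv M h p : agree M.+1 h p -> agree M (sderiv h) p^`().
Proof. by move=> H k lt; rewrite coef_deriv /sderiv H // mulr_natr. Qed.

Definition trunc M (f : nat -> nat -> C) : {poly {poly C}} :=
  \poly_(j < M) \poly_(i < M) f i j.

Definition curve_eval M (F : {poly {poly C}}) : {poly C} :=
  (map_poly (comp_poly 'X^n) F).[psi a M].

Lemma ev_psi M F : ev n (psi a M)%:P F = (curve_eval M F)%:P.
Proof. by rewrite /ev comp_polyCr. Qed.

Lemma sum_ord_trunc (F : nat -> C) k M : (k < M)%N ->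
  (forall i, (k < i)%N -> F i = 0) -> \sum_(i < k.+1) F i = \sum_(i < M) F i.
Proof.
move=> lt H; rewrite -!(big_mkord xpredT) (@big_cat_nat _ _ _ k.+1 0 M) //=.
rewrite [X in _ = _ + X]big_nat [X in _ = _ + X]big1 ?addr0 // => i /andP[ki _].
exact: H.
Qed.

(** Both coordinates vanish at [t = 0], so [x^i y^j] has order at least [n i + j]. This reconciles
    the cutoff [k] in [scomp] with the cutoff [M] in [trunc]. *)
Lemma coef_mono_curve M i j k : (k < M)%N -> (k < i)%N || (k < j)%N ->
  ('X^n ^+ i * psi a M ^+ j)`_k = 0.
Proof.
move=> lt H.
have [p ->] : exists p, psi a M = 'X * p.
  exists (drop_poly 1 (psi a M)); apply/polyP=> -[|l]; rewrite coefXM /=.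
    by rewrite coef_poly (leq_ltn_trans (leq0n k) lt).
  by rewrite coef_drop_poly addn1.
rewrite exprMn mulrA -exprM -exprD coefXnM ifT //.
by case/orP: H => H; apply: leq_trans H _; [rewrite (leq_trans _ (leq_addr _ _)) ?leq_pmull | apply: leq_addl].
Qed.

Lemma agree_scomp M f : agree M (scomp f (tpow C n) a) (curve_eval M (trunc M f)).
Proof.
move=> k lt.
have Eij i j : smul (spow (tpow C n) i) (spow a j) k = ('X^n ^+ i * psi a M ^+ j)`_k.
  apply: (agree_smul (M := M)) => //; apply: agree_spow; first exact: agree_tpow.
  exact: agree_psi.
have -> : curve_eval M (trunc M f) =
    \sum_(j < M) \sum_(i < M) f i j *: ('X^n ^+ i * psi a M ^+ j).
  rewrite /curve_eval /trunc poly_def rmorph_sum horner_sum; apply: eq_bigr => j _.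
  rewrite -mul_polyC rmorphM /= map_polyC map_polyXn /= hornerM hornerXn hornerC.
  rewrite poly_def rmorph_sum mulr_suml; apply: eq_bigr => i _.
  by rewrite /= comp_polyZ comp_Xn_poly -scalerAl.
rewrite exchange_big coef_sum /=.
pose G i j := f i j * ('X^n ^+ i * psi a M ^+ j)`_k.
have -> : scomp f (tpow C n) a k = \sum_(i < k.+1) \sum_(j < k.+1) G i j.
  by apply: eq_bigr => i _; apply: eq_bigr => j _; rewrite Eij.
rewrite (sum_ord_trunc (F := fun i => \sum_(j < k.+1) G i j) lt); last first.
  by move=> i ki; rewrite big1 // => j _; rewrite /G coef_mono_curve ?ki ?mulr0.
apply: eq_bigr => i _; rewrite coef_sum (sum_ord_trunc (F := G i) lt); last first.
  by move=> j kj; rewrite /G coef_mono_curve ?kj ?orbT ?mulr0.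
by apply: eq_bigr => j _; rewrite coefZ.
Qed.

(** [formH] is the coefficient of [dt/t], not of [dt]; the extra factor [t] accounts for the [+ 1]
    in the value of a form. *)
Lemma formH_psi M F G : formH n (psi a M)%:P F G =
  ('X * (curve_eval M F * ('X^n)^`() + curve_eval M G * (psi a M)^`()))%:P.
Proof.
rewrite /formH !ev_psi thetaC -!polyCM -polyCD; congr (_%:P).
by rewrite derivXn -{1}(prednK n_gt0) exprS; ring.
Qed.

Lemma pullbackE M A B k : (k.+1 < M)%N ->
  pullback n a A B k = (formH n (psi a M)%:P (trunc M A) (trunc M B))`_0`_k.+1.
Proof.
case: M => // M lt.
rewrite formH_psi coefC coefXM /= coefD /pullback.
have lift h p : agree M.+1 h p -> agree M h p by move=> H l lt'; apply/H/ltnW.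
congr (_ + _); apply: (@agree_smul M) => //.
- exact/lift/agree_scomp.
- exact/agree_sderiv/agree_tpow.
- exact/lift/agree_scomp.
- exact/agree_sderiv/agree_psi.
Qed.

Lemma lead_constP k (p : {poly C}) :
  lead k p%:P (p`_k)%:P <-> forall l, (l < k)%N -> p`_l = 0.
Proof.
split=> [/leadP/(_ 0%N)[_ H] l /H|H]; first by rewrite coefC.
apply/leadP=> m; rewrite !coefC; case: (m =P 0%N) => // _.
by rewrite coef0; split=> // l; rewrite coef0.
Qed.

Lemma lead_scomp M f s : (s < M)%N -> ord_is (scomp f (tpow C n) a) s ->
  exists2 p, p != 0 & lead s (ev n (psi a M)%:P (trunc M f)) p%:P.
Proof.
move=> lt [low nz]; have E := @agree_scomp M f.
exists (curve_eval M (trunc M f))`_s; first by rewrite -E.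
by rewrite ev_psi; apply/lead_constP => l ls; rewrite -E ?low // (ltn_trans ls).
Qed.

Lemma lead_pullback M A B k : (k.+1 < M)%N -> ord_is (pullback n a A B) k ->
  exists2 p, p != 0 &
    lead k.+1 (formH n (psi a M)%:P (trunc M A) (trunc M B)) p%:P.
Proof.
move=> lt [low nz]; have E l := @pullbackE M A B l.
set H := formH _ _ _ _ in E *.
have [p Ep p0] : exists2 p : {poly C}, H = p%:P & p`_0 = 0.
  by rewrite /H formH_psi; eexists; [by [] | rewrite coefXM].
have Hp l : (l.+1 < M)%N -> pullback n a A B l = p`_l.+1.
  by move=> ltl; rewrite E // Ep coefC.
exists p`_k.+1; first by rewrite -Hp.
rewrite Ep; apply/lead_constP => -[//|l] ls.
by rewrite -Hp ?low // (ltn_trans ls).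
Qed.

Definition coef_family (F : {poly {poly C}}) : nat -> nat -> C := fun i j => F`_j`_i.

Lemma conv2_coef_family F : conv2 (coef_family F).
Proof.
exists 1, (\sum_(j < size F) \sum_(i < size (F`_j)%R) `|F`_j`_i|); split=> // i j.
rewrite expr1n mulr1 /coef_family.
have pos : 0 <= \sum_(j < size F) \sum_(i < size (F`_j)%R) `|F`_j`_i|.
  by do 2!apply: sumr_ge0 => ? _.
have [lj|lj] := ltnP j (size F); last by rewrite (nth_default 0 lj) coef0 normr0.
have [li|li] := ltnP i (size (F`_j)%R); last by rewrite (nth_default 0 li) normr0.
rewrite (bigD1 (Ordinal lj)) //= (bigD1 (Ordinal li)) //= -addrA lerDl addr_ge0 //.
  by apply: sumr_ge0.
by do 2!apply: sumr_ge0 => ? _.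
Qed.

Lemma trunc_coef_family F : exists M0, forall M, (M0 <= M)%N -> trunc M (coef_family F) = F.
Proof.
exists (size F + \sum_(j < size F) size (F`_j)%R)%N => M le.
apply/polyP=> j; rewrite coef_poly; case: ltnP => [lt|ge].
  apply/polyP=> i; rewrite coef_poly; case: ltnP => // ge.
  rewrite nth_default // (leq_trans _ ge) //.
  have [lj|lj] := ltnP j (size F); last by rewrite (nth_default 0 lj) size_poly0.
  apply: leq_trans le; rewrite (bigD1 (Ordinal lj)) //=.
  by rewrite addnCA leq_addr.
by rewrite nth_default // (leq_trans _ ge) // (leq_trans (leq_addr _ _) le).
Qed.

(** Polynomial coefficients converge, and one long truncation of the branch determines the pullback
    up to the order needed. *)
Lemma values_forms_lead A B k p : (0 < k)%N -> p != 0 ->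
  (exists M0, forall M, (M0 <= M)%N -> lead k (formH n (psi a M)%:P A B) p%:P) ->
  values_forms n a k.
Proof.
case: k => // k _ p0 [M0 HM0].
have [MA HA] := trunc_coef_family A; have [MB HB] := trunc_coef_family B.
pose M := (M0 + MA + MB + k.+2)%N.
have HM := HM0 M; have {HM} HM : lead k.+1 (formH n (psi a M)%:P A B) p%:P.
  by apply: HM; rewrite /M; lia.
have E l : (l <= k)%N -> pullback n a (coef_family A) (coef_family B) l =
    (formH n (psi a M)%:P A B)`_0`_l.+1.
  move=> le; rewrite (@pullbackE M); last by rewrite /M; lia.
  by rewrite HA ?HB //; rewrite /M; lia.
exists (coef_family A), (coef_family B); split; first exact: conv2_coef_family.
split; first exact: conv2_coef_family.
exists k; split=> //; split=> [l lt|].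
  rewrite E; last exact: ltnW.
  by have [_ ->] := (proj1 (leadP _ _ _) HM) 0%N.
by rewrite E // -(coef_lead 0 HM) coefC.
Qed.

Lemma values_forms_mult : values_forms n a n.
Proof.
apply: (@values_forms_lead 1 0 n n%:R) => //; first by rewrite pnatr_eq0 -lt0n.
exists 0%N => M _; rewrite /formH rmorph1 rmorph0 mul0r addr0 mul1r.
have -> : n%:R = ('X^n *+ n : {poly C})`_n by rewrite coefMn coefXn eqxx.
by apply/lead_constP => l lt; rewrite coefMn coefXn (ltn_eqF lt) mul0rn.
Qed.

(** The derivatives of both coordinates vanish to order at least [n - 1]. *)
Lemma values_forms_ge m : (forall k, (k < n)%N -> a k = 0) ->
  values_forms n a m -> (n <= m)%N.
Proof.
move=> low [A [B [_ [_ [k [[_ nz] ->]]]]]]; rewrite leqNgt; apply: contraNN nz => lt.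
have H (h h' : nat -> C) : (forall l, (l < n)%N -> h' l = 0) -> smul h (sderiv h') k = 0.
  move=> Hl; rewrite /smul big1 // => l _; rewrite /sderiv Hl ?mul0r ?mulr0 //.
  by apply: leq_ltn_trans lt; rewrite ltnS leq_subr.
by rewrite /pullback !H ?addr0 // => l ltl; rewrite /tpow (ltn_eqF ltl).
Qed.

Lemma semigroup_gt0 s : semigroup n a s -> (0 < s)%N.
Proof.
case=> f [_ [f0 [_ nz]]]; rewrite lt0n; apply: contraNneq nz => ->.
by rewrite /scomp !big_ord1 f0 mul0r.
Qed.

End Series.

(** * The generators of the semigroup in the basis of values *)

Theorem S_basis_contains_generators (C : numClosedFieldType) (n : nat) (a : nat -> C)
  (hn : (2 <= n)%N)
  (ha_normal : exists beta1 : nat,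
      [/\ (n < beta1)%N, ~~ (n %| beta1)%N, a beta1 != 0 &
          forall k, (k < beta1)%N -> a k = 0])
  (g : nat) (b : nat -> nat) (hchar : char_exps n a g b)
  (T : nat -> Prop)
  (hT : is_S_basis (semigroup n a) (values_forms n a) T) :
  T n /\ forall j, (1 <= j <= g)%N -> T (betabar n b j).
Proof.
have n_gt0 : (0 < n)%N by apply: ltnW.
have g_gt0 : (0 < g)%N.
  by case: g hchar => // -[_ /= E]; move: hn; rewrite E.
have [beta1 [n_lt b1_nd ab1 low]] := ha_normal.
(* A smaller [b 1] would have zero coefficient; a larger one would make [n] divide [beta1]. *)
have b1E : b 1 = beta1.
  have [ab nd Hb] := proj1 hchar 1%N g_gt0.
  case: (ltngtP (b 1) beta1) => // [lt|lt].
    by move: ab; rewrite low ?eqxx.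
  by move: b1_nd; rewrite (Hb _ lt ab1).
have a_low k : (k < b 1)%N -> a k = 0 by rewrite b1E; apply: low.
have b1_gt0 : (0 < b 1)%N by rewrite b1E (ltn_trans n_gt0).
have a0 : a 0%N = 0 by apply: a_low.
have [TL [gen _]] := hT; split.
  have [t [s [Tt [_ E]]]] := (proj1 (gen n)) (values_forms_mult n_gt0 a0).
  have le : (n <= t)%N.
    by apply: values_forms_ge (TL t Tt) => k lt; apply: low; exact: ltn_trans lt n_lt.
  by have <- : t = n by move: le; rewrite {1}E; lia.
case=> // i /andP[_ lt].
have [z z_prim] := prim_root_exists C n_gt0.
have [f [g0 [_ _ g00 f_lead]]] := semiroot n_gt0 hchar z_prim lt.
have mono j : (j < i)%N -> (b j.+1 <= b j.+2)%N.
  by move=> ltji; rewrite ltnW // (b_lt hchar) // (leq_ltn_trans ltji).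
(* Long truncations of the branch lie in [chart i] as the curve [u = W(t)]. *)
have psiE M : (b i.+1 < M)%N -> exists2 W : {poly C}, W.[0] = a (b i.+1) &
    (psi a M)%:P = chart b a i \Po W%:P.
  move=> ltM; exists (\poly_(k < M - b i.+1) a (k + b i.+1)%N).
    by rewrite horner_coef0 coef_poly subn_gt0 ltM.
  by rewrite -[X in _ \Po X]addr0 chart_comp mulr0 addr0 -poly_chart_shift.
have Lb : values_forms n a (betabar n b i.+1).
  have c0 := b_neq0 hchar lt.
  have bb_gt0 : (0 < betabar n b i.+1)%N.
    rewrite betabarE // addn_gt0 orbC; case: i lt {f_lead psiE mono c0} => [|i] lt.
      by rewrite b1_gt0.
    by rewrite (ltn_trans b1_gt0) // (b_lt hchar).
  (* The form is the differential of the semiroot: its [dt/t] part is [theta] of [f] on the branch,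
     which multiplies the leading coefficient by the order. *)
  apply: (@values_forms_lead _ n a n_gt0 a0 (dx f) f^`() _
           (g0 * a (b i.+1) *+ betabar n b i.+1)) => //.
    by rewrite mulrn_eq0 mulf_eq0 (negPf g00) (negPf c0) (gtn_eqF bb_gt0).
  exists (b i.+1).+1 => M ltM; have [W Wc ->] := psiE M ltM.
  rewrite /formH -theta_ev // polyCMn; apply: lead_theta.
  rewrite ev_comp betabarE //.
  have := lead_comp f_lead (c := a (b i.+1)) (W := W%:P).
  rewrite hornerZ hornerX; apply.
  by rewrite /at_t0 map_polyC /= horner_evalE Wc.
have [t [s [Tt [Ss E]]]] := (proj1 (gen _)) Lb.
case: Ss => [s0|Ss]; first by rewrite E s0 addn0.
have [A [B [_ [_ [k [Hk Et]]]]]] := TL t Tt.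
have s_gt0 := semigroup_gt0 Ss; have [F [_ [_ HF]]] := Ss.
(* Long enough to contain the term of exponent [b i.+1] and to detect both orders [s] and [t]. *)
pose M := (b i.+1 + s + t).+1.
have [|p p0 Hp] := @lead_scomp _ n a n_gt0 a0 M F s _ HF; first by rewrite /M; lia.
have [|q q0 Hq] := @lead_pullback _ n a n_gt0 a0 M A B k _ Hk; first by rewrite /M; lia.
have [|W Wc EW] := psiE M; first by rewrite /M; lia.
rewrite -Et EW in Hp Hq.
have t_gt0 : (0 < t)%N by rewrite Et.
have /eqP[] := no_factorization n_gt0 hchar g_gt0 b1_gt0 a_low lt Wc s_gt0 t_gt0 p0 q0 Hp Hq.
by rewrite E addnC.
Qed.

Theorem theorem1p3 (R : realType) (n : nat) (a : nat -> R[i])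
  (hn : (2 <= n)%N)
  (ha_conv : conv1 a)
  (ha_normal : exists beta1 : nat,
      [/\ (n < beta1)%N, ~~ (n %| beta1)%N, a beta1 != 0 &
          forall k, (k < beta1)%N -> a k = 0])
  (ha_prim : forall d : nat, (d %| n)%N ->
      (forall k, a k != 0 -> (d %| k)%N) -> d = 1%N)
  (g : nat) (b : nat -> nat) (hchar : char_exps n a g b)
  (T : nat -> Prop)
  (hT : is_S_basis (semigroup n a) (values_forms n a) T) :
  T n /\ forall j, (1 <= j <= g)%N -> T (betabar n b j).
Proof. exact: (@S_basis_contains_generators _ n a hn ha_normal g b hchar T hT). Qed.
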